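(* Let $F$ be a finitely generated free group of rank at least two. Then every proper quotient of the abstract commensurator $\mathrm{Comm}(F)$ is abelian; that is, for every non-trivial normal subgroup $N$ of $\mathrm{Comm}(F)$, the group $\mathrm{Comm}(F)/N$ is abelian.
   Context: Let $\Gamma$ be a group. A virtual isomorphism of $\Gamma$ is an isomorphism $\varphi: A \to B$ between finite index subgroups $A,B$ of $\Gamma$. Two virtual isomorphisms are equivalent if they agree on a common finite index subgroup of their domains. The composition of $\varphi: A\to B$ followed by $\psi: C \to D$ is the isomorphism $\varphi^{-1}(B\cap C) \to \psi(B\cap C)$, $x \mapsto \psi(\varphi(x))$. Equivalence classes of virtual isomorphisms of $\Gamma$ form a group under composition, the abstract commensurator $\mathrm{Comm}(\Gamma)$. *)

(* Defs.v *)
From HB Require Import structures.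
From mathcomp Require Import all_boot.
From mathcomp Require Import all_classical.

Set Implicit Arguments.
Unset Strict Implicit.
Unset Printing Implicit Defensive.

Local Open Scope classical_set_scope.
Local Open Scope group_scope.
Local Open Scope quotient_scope.

Definition is_subgroup (G : groupType) (A : set G) : Prop :=
  group_closed [in A].

Definition lcosets_of (G : groupType) (A : set G) : set (set G) :=
  [set [set x * a | a in A] | x in [set: G]].

Definition fi_subgroup (G : groupType) (A : set G) : Prop :=
  is_subgroup A /\ finite_set (lcosets_of A).

Section SubgroupTheory.
Variable G : groupType.

Lemma is_subgroupP (A : set G) :
  is_subgroup A <-> A 1 /\ (forall x y, A x -> A y -> A (x / y)).
Proof.
split=> [[A1 AB]|[A1 AB]].
  split=> [|x y Ax Ay]; first by move: A1; rewrite inE.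
  by have := AB x y; rewrite !inE; apply.
by split=> [|x y]; rewrite !inE //; apply: AB.
Qed.

Lemma subgroup1 (A : set G) : is_subgroup A -> A 1.
Proof. by case/is_subgroupP. Qed.

Lemma subgroupV (A : set G) x : is_subgroup A -> A x -> A x^-1.
Proof. by case/is_subgroupP => A1 AB Ax; rewrite -[x^-1]mul1g; apply: AB. Qed.

Lemma subgroupM (A : set G) x y : is_subgroup A -> A x -> A y -> A (x * y).
Proof.
move=> gA Ax Ay; rewrite -[y]invgK.
by case/is_subgroupP: (gA) => _; apply => //; apply: subgroupV.
Qed.

Lemma fi_subgroupP (A : set G) : fi_subgroup A <->
  is_subgroup A /\
  exists s : seq G, forall x, exists2 y, y \in s & A (y^-1 * x).
Proof.
split=> -[gA]; last first.
  move=> [s sP]; split=> //.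
  apply: (@sub_finite_set _ _
    [set [set y * a | a in A] | y in [set` s]]); last first.
    by apply: finite_image; exact: finite_seq.
  move=> _ [x _ <-]; have [y ys Ayx] := sP x; exists y => //.
  apply/seteqP; split=> _ [a Aa <-].
    exists ((y^-1 * x)^-1 * a); first by apply: subgroupM => //; apply: subgroupV.
    by rewrite invgM invgK !mulgA mulgV mul1g.
  exists (y^-1 * x * a); first by apply: subgroupM.
  by rewrite !mulgA mulgV mul1g.
move=> fA; split=> //.
pose c x : set G := [set x * a | a in A].
have xc x : c x x by exists 1; rewrite ?mulg1 //; apply: subgroup1.
have [s sP] : exists s : seq (set G), lcosets_of A = [set` s].
  by have [s ->] := (finite_seqP _).1 fA; exists s.
have [r rP] : {r : set G -> G & forall C, lcosets_of A C -> c (r C) = C}.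
  apply: (@choice _ _ (fun C y => lcosets_of A C -> c y = C)) => C.
  have [[y _ yC]|nC] := pselect (lcosets_of A C); first by exists y.
  by exists 1 => /nC.
exists (map r s) => x; have cx : lcosets_of A (c x) by exists x.
exists (r (c x)); first by apply: map_f; move: (cx); rewrite sP.
have : c (r (c x)) x by rewrite (rP _ cx).
by move: (r _) => y [a Aa <-]; rewrite mulgA mulVg mul1g.
Qed.

Lemma is_subgroupI (A B : set G) :
  is_subgroup A -> is_subgroup B -> is_subgroup (A `&` B).
Proof.
move=> /is_subgroupP[A1 AB] /is_subgroupP[B1 BB]; apply/is_subgroupP.
by split=> // x y [Ax Bx] [Ay By]; split; [apply: AB|apply: BB].
Qed.

Lemma fi_subgroupT : fi_subgroup [set: G].
Proof.
apply/fi_subgroupP; split; first exact/is_subgroupP.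
by exists [:: 1] => x; exists 1; rewrite ?inE.
Qed.

Lemma fi_subgroupI (A B : set G) :
  fi_subgroup A -> fi_subgroup B -> fi_subgroup (A `&` B).
Proof.
move=> /fi_subgroupP[gA [s sP]] /fi_subgroupP[gB [t tP]].
apply/fi_subgroupP; split; first exact: is_subgroupI.
pose P (p : G * G) z := A (p.1^-1 * z) /\ B (p.2^-1 * z).
have [r rP] : {r : G * G -> G & forall p, (exists z, P p z) -> P p (r p)}.
  apply: (@choice _ _ (fun p z => (exists z, P p z) -> P p z)) => p.
  have [[z Pz]|nP] := pselect (exists z, P p z); first by exists z.
  by exists 1 => /nP.
exists [seq r (a, b) | a <- s, b <- t] => x.
have [a sa Aa] := sP x; have [b tb Bb] := tP x.
have [/= Ar Br] : P (a, b) (r (a, b)) by apply: rP; exists x.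
exists (r (a, b)); first by apply/allpairsP; exists (a, b).
suff E c : (r (a, b))^-1 * x = (c^-1 * r (a, b))^-1 * (c^-1 * x).
  split; [rewrite (E a)|rewrite (E b)].
    by apply: subgroupM => //; apply: subgroupV.
  by apply: subgroupM => //; apply: subgroupV.
by rewrite invgM invgK !mulgA -[_ * c * c^-1]mulgA mulgV mulg1.
Qed.

End SubgroupTheory.

(* A virtual isomorphism between finite index subgroups [vdom] and [vcod] is
   carried by a total function whose values outside [vdom] are irrelevant. *)
Record virt_iso (G : groupType) := VirtIso {
  vdom : set G;
  vcod : set G;
  vfun :> G -> G;
  vdom_fi : fi_subgroup vdom;
  vcod_fi : fi_subgroup vcod;
  vbij : set_bij vdom vcod vfun;
  vmorph : {in vdom &, {morph vfun : x y / x * y}}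
}.

Definition virt_equiv (G : groupType) (f g : virt_iso G) : Prop :=
  exists A : set G, [/\ fi_subgroup A, A `<=` vdom f `&` vdom g &
                        forall x, A x -> f x = g x].

Section VirtIsoTheory.
Variable G : groupType.
Implicit Types (f g h : virt_iso G) (A B : set G).

Lemma vfun_cod f x : vdom f x -> vcod f (f x).
Proof. by case: (vbij f) => F _ _; apply: F. Qed.

Lemma vfun_inj f x y : vdom f x -> vdom f y -> f x = f y -> x = y.
Proof. by case: (vbij f) => _ I _ fx fy; apply: I; rewrite ?inE. Qed.

Lemma vfun_surj f y : vcod f y -> exists2 x, vdom f x & f x = y.
Proof. by case: (vbij f) => _ _ S; apply: S. Qed.

Lemma vfunM f x y : vdom f x -> vdom f y -> f (x * y) = f x * f y.
Proof. by move=> fx fy; apply: vmorph; rewrite inE. Qed.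

Lemma vdom_gr f : is_subgroup (vdom f).
Proof. by case: (vdom_fi f). Qed.

Lemma vcod_gr f : is_subgroup (vcod f).
Proof. by case: (vcod_fi f). Qed.

Lemma vfun1 f : f 1 = 1.
Proof.
have f1 : vdom f 1 by apply: subgroup1 (vdom_gr f).
by apply: (mulgI (f 1)); rewrite -vfunM // !mulg1.
Qed.

Lemma vfunV f x : vdom f x -> f x^-1 = (f x)^-1.
Proof.
move=> fx; have fV : vdom f x^-1 by apply: subgroupV => //; apply: vdom_gr.
by apply: (mulgI (f x)); rewrite -vfunM // !mulgV vfun1.
Qed.

Lemma fi_subgroup_image f A :
  fi_subgroup A -> fi_subgroup [set f x | x in vdom f `&` A].
Proof.
move=> fiA; have := fi_subgroupI (vdom_fi f) fiA.
set D := _ `&` _ => /fi_subgroupP[gD [s sP]].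
have [_ [t tP]] := (fi_subgroupP _).1 (vcod_fi f).
apply/fi_subgroupP; split.
  apply/is_subgroupP; split; first by exists 1; [apply: subgroup1|apply: vfun1].
  move=> _ _ [x Dx <-] [y Dy <-]; exists (x / y).
    by case/is_subgroupP: gD => _; apply.
  have Vy : D y^-1 by exact: subgroupV.
  by rewrite vfunM ?vfunV //; [case: Dy|case: Dx|case: Vy].
exists [seq b * f a | b <- t, a <- s] => x.
have [b tb /vfun_surj[a fa E]] := tP x.
have [c sc Dca] := sP a.
have Dc : vdom f c.
  rewrite -[c]invgK -[c^-1](mulgK a); apply: (subgroupV (vdom_gr f)).
  apply: (subgroupM (vdom_gr f)); first by case: Dca.
  exact: (subgroupV (vdom_gr f)).
exists (b * f c); first by apply/allpairsP; exists (b, c).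
exists (c^-1 * a) => //; rewrite vfunM ?vfunV ?E //.
  by rewrite invgM mulgA.
exact: (subgroupV (vdom_gr f)).
Qed.

Fact vid_bij : set_bij [set: G] [set: G] idfun.
Proof. by split=> // x _; exists x. Qed.

Definition vid : virt_iso G :=
  @VirtIso G _ _ idfun (@fi_subgroupT G) (@fi_subgroupT G) vid_bij
    (fun _ _ _ _ => erefl).

Section Inverse.
Variable f : virt_iso G.
Let g : G -> G := 'pinv_(fun=> 1) (vdom f) f.

Fact vinv_bij : set_bij (vcod f) (vdom f) g.
Proof. exact/bijpinv_bij/vbij. Qed.

Fact vinv_can y : vcod f y -> f (g y) = y.
Proof.
have [_ _ S] := vbij f => fy.
by apply: (surjpK (fun=> 1) S); rewrite inE.
Qed.

Fact vinv_morph : {in vcod f &, {morph g : x y / x * y}}.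
Proof.
move=> x y; rewrite !inE => fx fy.
have [F _ _] := vinv_bij.
have fxy : vcod f (x * y) by apply: subgroupM => //; apply: vcod_gr.
apply: (@vfun_inj f); first exact: F.
  by apply: subgroupM; [apply: vdom_gr|apply: F|apply: F].
by rewrite vfunM ?vinv_can //; apply: F.
Qed.

Definition vinv : virt_iso G :=
  VirtIso (vcod_fi f) (vdom_fi f) vinv_bij vinv_morph.

End Inverse.

Lemma vinvK f y : vcod f y -> f (vinv f y) = y.
Proof. exact: vinv_can. Qed.

Lemma vfunK f x : vdom f x -> vinv f (f x) = x.
Proof.
move=> fx; apply: (@vfun_inj f) => //; last by rewrite vinvK //; apply: vfun_cod.
exact/(@vfun_cod (vinv f))/vfun_cod.
Qed.

Lemma fi_subgroup_preimage f A :
  fi_subgroup A -> fi_subgroup (vdom f `&` f @^-1` A).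
Proof.
move=> /(@fi_subgroup_image (vinv f)); congr fi_subgroup.
apply/seteqP; split=> [_ [y [/= fy Ay] <-]|x [fx Afx]].
  by split=> [|/=]; [apply: (@vfun_cod (vinv f))|rewrite vinvK].
by exists (f x); [split=> //=; apply: vfun_cod|rewrite vfunK].
Qed.

Section Composition.
Variables f g : virt_iso G.
Let D := vdom f `&` f @^-1` (vcod f `&` vdom g).
Let E := [set g y | y in vcod f `&` vdom g].

Fact vcomp_dom_fi : fi_subgroup D.
Proof.
by apply: fi_subgroup_preimage; apply: fi_subgroupI; [apply: vcod_fi|apply: vdom_fi].
Qed.

Fact vcomp_cod_fi : fi_subgroup E.
Proof.
have := fi_subgroup_image g (vcod_fi f); congr fi_subgroup.
by rewrite setIC.
Qed.

Fact vcomp_bij : set_bij D E (g \o f).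
Proof.
split=> [x [fx [cfx gfx]]|x y|_ [y [fy gy] <-]].
- by exists (f x).
- rewrite !inE => -[fx [_ gfx]] [fy [_ gfy]] /(vfun_inj gfx gfy).
  exact: vfun_inj.
- have [x fx xy] := vfun_surj fy.
  by exists x; rewrite /= ?xy //; split=> //=; rewrite xy.
Qed.

Fact vcomp_morph : {in D &, {morph g \o f : x y / x * y}}.
Proof.
by move=> x y; rewrite !inE => -[fx [_ gfx]] [fy [_ gfy]] /=; rewrite !vfunM.
Qed.

(* [f] followed by [g]. *)
Definition vcomp : virt_iso G :=
  VirtIso vcomp_dom_fi vcomp_cod_fi vcomp_bij vcomp_morph.

End Composition.

Lemma virt_equiv_refl f : virt_equiv f f.
Proof. by exists (vdom f); split=> //; exact: vdom_fi. Qed.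

Lemma virt_equiv_sym f g : virt_equiv f g -> virt_equiv g f.
Proof.
move=> [A [fiA sA eA]]; exists A; split=> // [x /sA[]//|x Ax].
by rewrite eA.
Qed.

Lemma virt_equiv_trans g f h :
  virt_equiv f g -> virt_equiv g h -> virt_equiv f h.
Proof.
move=> [A [fiA sA eA]] [B [fiB sB eB]]; exists (A `&` B); split.
- exact: fi_subgroupI.
- by move=> x [/sA[? ?] /sB[? ?]].
- by move=> x [Ax Bx]; rewrite eA ?eB.
Qed.

Lemma virt_equiv_comp f f' g g' : virt_equiv f f' -> virt_equiv g g' ->
  virt_equiv (vcomp f g) (vcomp f' g').
Proof.
move=> [A [fiA sA eA]] [B [fiB sB eB]].
exists (A `&` (vdom f `&` f @^-1` B)); split.
- by apply: fi_subgroupI => //; apply: fi_subgroup_preimage.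
- move=> x [Ax [fx /= Bfx]]; have [_ f'x] := sA _ Ax; have [gx g'x] := sB _ Bfx.
  split; split=> //=; split=> //; first exact: vfun_cod.
    exact: vfun_cod.
  by rewrite -eA.
- by move=> x [Ax [fx Bfx]] /=; rewrite -eA ?eB.
Qed.

Lemma virt_equiv_ext f g : vdom f `<=` vdom g ->
  (forall x, vdom f x -> f x = g x) -> virt_equiv f g.
Proof.
by move=> sfg efg; exists (vdom f); split=> //; [apply: vdom_fi|move=> x; split=> //; apply: sfg].
Qed.

Lemma vcompA f g h :
  virt_equiv (vcomp f (vcomp g h)) (vcomp (vcomp f g) h).
Proof.
apply: virt_equiv_ext => // x [fx [cfx [gfx [cgfx hgfx]]]].
by split=> //=; split=> //; exists (f x).
Qed.

Lemma vcomp1f f : virt_equiv (vcomp vid f) f.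
Proof. by apply: virt_equiv_ext => // x [_ []]. Qed.

Lemma vcompf1 f : virt_equiv (vcomp f vid) f.
Proof. by apply: virt_equiv_ext => // x []. Qed.

Lemma vcompVf f : virt_equiv (vcomp (vinv f) f) vid.
Proof. by apply: virt_equiv_ext => // x [/= fx _]; apply: vinvK. Qed.

Lemma vcompfV f : virt_equiv (vcomp f (vinv f)) vid.
Proof. by apply: virt_equiv_ext => // x [/= fx _]; apply: vfunK. Qed.

Lemma virt_equiv_inv f g : virt_equiv f g -> virt_equiv (vinv f) (vinv g).
Proof.
move=> fg; apply: (virt_equiv_trans (virt_equiv_sym (vcompf1 _))).
apply: (virt_equiv_trans
  (virt_equiv_comp (virt_equiv_refl _) (virt_equiv_sym (vcompfV g)))).
apply: (virt_equiv_trans (vcompA _ _ _)).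
apply: (virt_equiv_trans _ (vcomp1f _)).
apply: virt_equiv_comp; last exact: virt_equiv_refl.
apply: (virt_equiv_trans _ (vcompVf f)).
exact: virt_equiv_comp (virt_equiv_refl _) (virt_equiv_sym fg).
Qed.

End VirtIsoTheory.

HB.instance Definition _ (G : groupType) := gen_eqMixin (virt_iso G).
HB.instance Definition _ (G : groupType) := gen_choiceMixin (virt_iso G).

Section Comm.
Variable G : groupType.

Definition virt_equivb : rel (virt_iso G) := fun f g => `[< virt_equiv f g >].

Fact virt_equivb_refl : reflexive virt_equivb.
Proof. by move=> f; apply/asboolP; apply: virt_equiv_refl. Qed.

Fact virt_equivb_sym : symmetric virt_equivb.
Proof. by move=> f g; apply/asboolP/asboolP; apply: virt_equiv_sym. Qed.

Fact virt_equivb_trans : transitive virt_equivb.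
Proof.
by move=> f g h /asboolP fg /asboolP gh; apply/asboolP; apply: virt_equiv_trans gh.
Qed.

Canonical virt_equiv_rel :=
  EquivRel virt_equivb virt_equivb_refl virt_equivb_sym virt_equivb_trans.

Definition Comm : Type := {eq_quot virt_equivb}.
HB.instance Definition _ := Choice.on Comm.

Definition comm_class (f : virt_iso G) : Comm := \pi_{eq_quot virt_equivb} f.
Definition comm_repr (c : Comm) : virt_iso G :=
  repr (c : {eq_quot virt_equivb}).

Lemma comm_reprK : cancel comm_repr comm_class.
Proof. exact: reprK. Qed.

Lemma comm_classP f g : comm_class f = comm_class g <-> virt_equiv f g.
Proof.
by split=> [/eqmodP/asboolP|fg]; last exact/eqmodP/asboolP.
Qed.

Lemma comm_repr_class f : virt_equiv (comm_repr (comm_class f)) f.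
Proof. by apply/comm_classP; rewrite comm_reprK. Qed.

(* As for permutations in MathComp, a product [c * d] is [c] followed by [d]. *)
Definition comm_one : Comm := comm_class (vid G).
Definition comm_inv (c : Comm) : Comm := comm_class (vinv (comm_repr c)).
Definition comm_mul (c d : Comm) : Comm :=
  comm_class (vcomp (comm_repr c) (comm_repr d)).

Lemma comm_mul_class f g :
  comm_mul (comm_class f) (comm_class g) = comm_class (vcomp f g).
Proof. by apply/comm_classP; apply: virt_equiv_comp; apply: comm_repr_class. Qed.

Lemma comm_inv_class f : comm_inv (comm_class f) = comm_class (vinv f).
Proof. by apply/comm_classP; apply: virt_equiv_inv; apply: comm_repr_class. Qed.

Fact comm_mulA : associative comm_mul.
Proof.
move=> x y z; rewrite -[x]comm_reprK -[y]comm_reprK -[z]comm_reprK.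
by rewrite !comm_mul_class; apply/comm_classP; apply: vcompA.
Qed.

Fact comm_mul1g : left_id comm_one comm_mul.
Proof.
move=> x; rewrite -[x]comm_reprK comm_mul_class.
by apply/comm_classP; apply: vcomp1f.
Qed.

Fact comm_mulg1 : right_id comm_one comm_mul.
Proof.
move=> x; rewrite -[x]comm_reprK comm_mul_class.
by apply/comm_classP; apply: vcompf1.
Qed.

Fact comm_mulVg : left_inverse comm_one comm_inv comm_mul.
Proof.
move=> x; rewrite -[x]comm_reprK comm_inv_class comm_mul_class.
by apply/comm_classP; apply: vcompVf.
Qed.

Fact comm_mulgV : right_inverse comm_one comm_inv comm_mul.
Proof.
move=> x; rewrite -[x]comm_reprK comm_inv_class comm_mul_class.
by apply/comm_classP; apply: vcompfV.
Qed.

HB.instance Definition _ :=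
  isGroup.Build Comm comm_mulA comm_mul1g comm_mulg1 comm_mulVg comm_mulgV.

Lemma comm_classM f g : comm_class f * comm_class g = comm_class (vcomp f g).
Proof. exact: comm_mul_class. Qed.

Lemma comm_classV f : (comm_class f)^-1 = comm_class (vinv f).
Proof. exact: comm_inv_class. Qed.

End Comm.

Record normal_subgroup (G : groupType) := NormalSubgroup {
  nsub : set G;
  nsub_subgroup : is_subgroup nsub;
  nsub_normal : forall x y, nsub x -> nsub (x ^ y)
}.

Section Quotient.
Variables (G : groupType) (N : normal_subgroup G).

Definition coset_eqb : rel G := fun x y => `[< nsub N (x^-1 * y) >].

Fact coset_eqb_refl : reflexive coset_eqb.
Proof.
by move=> x; apply/asboolP; rewrite mulVg; apply: (subgroup1 (@nsub_subgroup _ N)).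
Qed.

Fact coset_eqb_sym : symmetric coset_eqb.
Proof.
have I x y : nsub N (x^-1 * y) -> nsub N (y^-1 * x).
  by move=> /(subgroupV (@nsub_subgroup _ N)); rewrite invgM invgK.
by move=> x y; apply/asboolP/asboolP; apply: I.
Qed.

Fact coset_eqb_trans : transitive coset_eqb.
Proof.
move=> y x z /asboolP xy /asboolP yz; apply/asboolP.
by have := subgroupM (@nsub_subgroup _ N) xy yz; rewrite mulgA mulgK.
Qed.

Canonical coset_equiv_rel :=
  EquivRel coset_eqb coset_eqb_refl coset_eqb_sym coset_eqb_trans.

Definition quotient_group : Type := {eq_quot coset_eqb}.
HB.instance Definition _ := Choice.on quotient_group.

Definition quo (x : G) : quotient_group := \pi_{eq_quot coset_eqb} x.
Definition quo_repr (u : quotient_group) : G :=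
  repr (u : {eq_quot coset_eqb}).

Lemma quo_reprK : cancel quo_repr quo.
Proof. exact: reprK. Qed.

Lemma quoP x y : quo x = quo y <-> nsub N (x^-1 * y).
Proof.
by split=> [/eqmodP/asboolP|xy]; last exact/eqmodP/asboolP.
Qed.

Lemma quo_repr_quo x : nsub N ((quo_repr (quo x))^-1 * x).
Proof. by apply/quoP; rewrite quo_reprK. Qed.

Definition quo_one : quotient_group := quo 1.
Definition quo_inv (u : quotient_group) : quotient_group :=
  quo (quo_repr u)^-1.
Definition quo_mul (u v : quotient_group) : quotient_group :=
  quo (quo_repr u * quo_repr v).

Lemma quo_mulE x y : quo_mul (quo x) (quo y) = quo (x * y).
Proof.
apply/quoP; set x' := quo_repr _; set y' := quo_repr _.
have -> : (x' * y')^-1 * (x * y) = (x'^-1 * x) ^ y' * (y'^-1 * y).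
  by rewrite conjgE invgM -!mulgA (mulgA y' y'^-1) mulgV mul1g.
apply: (subgroupM (@nsub_subgroup _ N)); last exact: quo_repr_quo.
by apply: nsub_normal; apply: quo_repr_quo.
Qed.

Lemma quo_invE x : quo_inv (quo x) = quo x^-1.
Proof.
apply/quoP; rewrite invgK; set x' := quo_repr _.
have -> : x' * x^-1 = ((x'^-1 * x) ^ x^-1)^-1.
  by rewrite conjgE invgK !mulgA mulgK invgM invgK.
apply: (subgroupV (@nsub_subgroup _ N)).
by apply: nsub_normal; apply: quo_repr_quo.
Qed.

Fact quo_mulA : associative quo_mul.
Proof.
move=> x y z; rewrite -[x]quo_reprK -[y]quo_reprK -[z]quo_reprK.
by rewrite !quo_mulE mulgA.
Qed.

Fact quo_mul1g : left_id quo_one quo_mul.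
Proof. by move=> x; rewrite -[x]quo_reprK quo_mulE mul1g. Qed.

Fact quo_mulg1 : right_id quo_one quo_mul.
Proof. by move=> x; rewrite -[x]quo_reprK quo_mulE mulg1. Qed.

Fact quo_mulVg : left_inverse quo_one quo_inv quo_mul.
Proof. by move=> x; rewrite -[x]quo_reprK quo_invE quo_mulE mulVg. Qed.

Fact quo_mulgV : right_inverse quo_one quo_inv quo_mul.
Proof. by move=> x; rewrite -[x]quo_reprK quo_invE quo_mulE mulgV. Qed.

HB.instance Definition _ := isGroup.Build quotient_group
  quo_mulA quo_mul1g quo_mulg1 quo_mulVg quo_mulgV.

Lemma quoM x y : quo x * quo y = quo (x * y).
Proof. exact: quo_mulE. Qed.

Lemma quoV x : (quo x)^-1 = quo x^-1.
Proof. exact: quo_invE. Qed.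

End Quotient.

Definition abelian_group (G : groupType) : Prop :=
  forall x y : G, commute x y.

Definition free_basis (F : groupType) (I : Type) (b : I -> F) : Prop :=
  forall (H : groupType) (h : I -> H),
    exists2 f : {multiplicative F -> H}, (forall i, f (b i) = h i) &
      forall g : {multiplicative F -> H}, (forall i, g (b i) = h i) -> g =1 f.

Definition free_of_rank (F : groupType) (n : nat) : Prop :=
  exists b : 'I_n -> F, free_basis b.

(* Main.v *)
Require Import Defs.
From HB Require Import structures.
From mathcomp Require Import all_boot.
From mathcomp Require Import fingroup perm cyclic zify.
From mathcomp Require Import all_classical.

(** Let [N] be a non-trivial normal subgroup of [Comm F]. The proof shows that
    classes of virtual isomorphisms become rigid modulo [N]: on a suitable
    subgroup [F0] of finite index, the image in the quotient of a class that
    carries [A] onto [B] depends on the subgroups [A] and [B] of [F0] only.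
    Commutation then follows from a construction with finite coverings.

    _Conjugations_. If the class of [phi] lies in [N] and [phi a <> a], its
    commutator with the conjugation by [a] is the conjugation by
    [phi a * a^-1]; so [N] contains the conjugation by some [g <> 1]
    ([inn_nontrivial]). By the argument of M. Hall, a cyclically reduced
    conjugate of [g] is part of a basis of a subgroup of finite index ([hall]),
    and it remains so in cyclic coverings, whose ranks are unbounded.

    _Displacement_. Unwind [g] in a double covering. Conjugation by [g]
    maps half of a basis of the covering group to elements of the other half.
    Hence a substitution supported on the first half is congruent modulo [N] to
    one supported on the second half, and substitutions supported on the first
    half commute modulo [N]. Transvections are commutators of such substitutions, so they lie in
    [N] ([displaced_transvection]); inversions follow by lifting to one more
    double covering ([invert_option]). Since all bases of the same rank are
    conjugate in [Comm F], this holds for all bases of all subgroups of finite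
    index of some [F0] of finite index ([good_framing]).

    _Rigidity_. By the theorem of Nielsen ([nielsen]) the elementary moves
    generate the automorphism group of a free group of finite rank. Therefore
    [N] contains every class that carries a subgroup of finite index of [F0]
    onto itself ([carries_self]), and the image of a class carrying [A] onto [B]
    depends on [A] and [B] only ([quo_carries]).

    _Commutation_. Let [c] carry [A] onto [B], with [A] and [B] in [F0]. For a
    large prime [q] let [E] be the kernel of a map from [F0] onto the cyclic
    group of order [q]. After a change of bases, which is invisible modulo [N],
    [c] also carries [A] meet [E] onto [B] meet [E] ([prime_cover]). These are
    point stabilizers in [E] for actions on a set whose size does not depend on
    [q], while the rank of [E] grows with [q]; so most generators of [E] act by
    a permutation that another generator realizes, and after one more change of
    basis only the generators in a prescribed half of a basis of [E] act
    non-trivially ([normal_position]). Write [S p] for the stabilizer when the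
    first half acts through [p] and the second half trivially. Modulo [N], [c]
    is then a class [r] that carries [S p] onto [S p'] and matches the conjugates
    of the second half of the basis in the two groups. If the second half acts
    on another set through [u], and [S p u] is the stabilizer of a pair of
    points, such an [r] carries [S p u] onto [S p' u] for all [u]
    ([half_covering_change]). In the same way a second class is represented by
    some [t] that carries [S p u] onto [S p u'] for all [p]. Both [r * t] and
    [t * r] carry [S p u] onto [S p' u'], so they agree modulo [N].

    Subgroups are described by words in their bases throughout: [framing a] says
    that the family [a] is a basis of a subgroup of finite index, [moves c a b]
    that the class [c] sends the family [a] to the family [b]. *)

Set Implicit Arguments.
Unset Strict Implicit.
Unset Printing Implicit Defensive.

Local Open Scope classical_set_scope.
Local Open Scope group_scope.

(** * Words and their evaluation *)

Definition sgn (G : groupType) (b : bool) (x : G) : G := if b then x^-1 else x.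

Definition word (J : Type) : Type := seq (bool * J).

Definition ev (G : groupType) (J : Type) (a : J -> G) (w : word J) : G :=
  foldr (fun x g => sgn x.1 (a x.2) * g) 1 w.

Definition linv (J : Type) (x : bool * J) : bool * J := (~~ x.1, x.2).
Definition winv (J : Type) (w : word J) : word J := rev (map (@linv J) w).

Definition wsub (J I : Type) (s : J -> word I) (w : word J) : word I :=
  flatten [seq if x.1 then winv (s x.2) else s x.2 | x <- w].

Section Eval.
Variables (G : groupType) (J : Type).
Implicit Types (a : J -> G) (w : word J).

Lemma sgnV b (x : G) : sgn (~~ b) x = (sgn b x)^-1.
Proof. by case: b; rewrite /= ?invgK. Qed.

Lemma ev_nil a : ev a [::] = 1. Proof. by []. Qed.

Lemma ev_cons a x w : ev a (x :: w) = sgn x.1 (a x.2) * ev a w.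
Proof. by []. Qed.

Lemma ev1 a x : ev a [:: x] = sgn x.1 (a x.2).
Proof. by rewrite ev_cons mulg1. Qed.

Lemma ev_cat a w1 w2 : ev a (w1 ++ w2) = ev a w1 * ev a w2.
Proof. by elim: w1 => [|x w1 IH] /=; rewrite ?mul1g // IH mulgA. Qed.

Lemma ev_rcons a w x : ev a (rcons w x) = ev a w * sgn x.1 (a x.2).
Proof. by rewrite -cats1 ev_cat ev1. Qed.

Lemma ev_winv a w : ev a (winv w) = (ev a w)^-1.
Proof.
elim: w => [|x w IH]; first by rewrite invg1.
by rewrite /winv /= rev_cons ev_rcons -/(winv w) IH /= sgnV invgM.
Qed.

Lemma ev_nseq a k j : ev a (nseq k (false, j)) = a j ^+ k.
Proof. by elim: k => [|k IH]; rewrite ?expg0 // expgS -IH. Qed.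

Lemma eq_ev a a' : a =1 a' -> ev a =1 ev a'.
Proof. by move=> e; elim=> [//|x w IH] /=; rewrite IH e. Qed.

Lemma ev_mor (H : groupType) (f : {multiplicative G -> H}) a w :
  f (ev a w) = ev (f \o a) w.
Proof.
have f1 : f 1 = 1 by apply: (mulgI (f 1)); rewrite -gmulfM !mulg1.
have fV x : f x^-1 = (f x)^-1.
  by apply: (mulgI (f x)); rewrite -gmulfM !mulgV.
elim: w => [//|[b j] w IH]; rewrite !ev_cons gmulfM IH.
by case: b => //=; rewrite fV.
Qed.

Lemma winvK : involutive (@winv J).
Proof.
move=> w; rewrite /winv map_rev revK -map_comp -[RHS]map_id.
by apply: eq_map => -[[] j].
Qed.

Lemma winv_cat w1 w2 : winv (w1 ++ w2) = winv w2 ++ winv w1.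
Proof. by rewrite /winv map_cat rev_cat. Qed.

Lemma size_winv w : size (winv w) = size w.
Proof. by rewrite size_rev size_map. Qed.

Lemma linvK : involutive (@linv J).
Proof. by move=> [[] j]. Qed.

End Eval.

Lemma ev_wsub (G : groupType) (J I : Type) (s : J -> word I) (a : I -> G) w :
  ev a (wsub s w) = ev (fun j => ev a (s j)) w.
Proof.
elim: w => [//|[b j] w IH]; rewrite /wsub /= ev_cat -/(wsub s w) IH.
by case: b => //=; rewrite ev_winv.
Qed.

(** * Reduced words and freeness *)

Section Reduced.
Variable J : eqType.
Implicit Types (w : word J) (x : bool * J).

Definition nocancel x y := y != linv x.
Definition reduced w := sorted nocancel w.

Definition cons_red x w : word J :=
  if w is y :: w' then if y == linv x then w' else x :: w else [:: x].

Definition reduce w : word J := foldr cons_red [::] w.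

Lemma cons_red_reduced x w : reduced w -> reduced (cons_red x w).
Proof.
case: w => [//|y w] /= r; case: eqVneq => [_|nyx]; first exact: path_sorted r.
by rewrite /= r andbT.
Qed.

Lemma reduce_reduced w : reduced (reduce w).
Proof. by elim: w => // x w; apply: cons_red_reduced. Qed.

Lemma ev_cons_red (G : groupType) (a : J -> G) x w :
  ev a (cons_red x w) = ev a (x :: w).
Proof.
case: w => [//|y w]; rewrite [cons_red _ _]/=; case: eqVneq => // ->.
by rewrite !ev_cons /= sgnV mulgA mulgV mul1g.
Qed.

Lemma ev_reduce (G : groupType) (a : J -> G) w : ev a (reduce w) = ev a w.
Proof. by elim: w => [//|x w IH]; rewrite ev_cons_red !ev_cons IH. Qed.

End Reduced.

(** Freeness by relations: a word that is trivial on [a] is trivial in every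
    group. Homomorphisms out of the subgroup generated by [a] are then given by
    the evaluation of words, without making this subgroup a type. *)
Definition free (G : groupType) (J : Type) (a : J -> G) : Prop :=
  forall w, ev a w = 1 -> forall (H : groupType) (h : J -> H), ev h w = 1.

Definition gen (G : groupType) (J : Type) (a : J -> G) : set G := range (ev a).

Lemma genP (G : groupType) (J : Type) (a : J -> G) w : gen a (ev a w).
Proof. by exists w. Qed.

Lemma gen_gen (G : groupType) (J : Type) (a : J -> G) j : gen a (a j).
Proof. by exists [:: (false, j)] => //; rewrite ev1. Qed.

Lemma gen_subgroup (G : groupType) (J : Type) (a : J -> G) :
  is_subgroup (gen a).
Proof.
apply/is_subgroupP; split; first by exists [::].
by move=> _ _ [u _ <-] [v _ <-]; exists (u ++ winv v); rewrite ?ev_cat ?ev_winv.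
Qed.

Lemma subgroup_ev (G : groupType) (J : Type) (a : J -> G) A w :
  is_subgroup A -> (forall j, A (a j)) -> A (ev a w).
Proof.
move=> gA aA; elim: w => [|[b j] w IH]; first exact: subgroup1 gA.
apply: (subgroupM gA) IH; case: b => /=; last exact: aA.
by apply: (subgroupV gA).
Qed.

Lemma gen_sub (G : groupType) (J : Type) (a : J -> G) A :
  is_subgroup A -> (forall j, A (a j)) -> gen a `<=` A.
Proof. by move=> gA aA _ [w _ <-]; apply: subgroup_ev. Qed.

Lemma free_eq (G H : groupType) (J : Type) (a : J -> G) (h : J -> H) u v :
  free a -> ev a u = ev a v -> ev h u = ev h v.
Proof.
move=> fa e; have /fa/(_ H h) : ev a (u ++ winv v) = 1.
  by rewrite ev_cat ev_winv e mulgV.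
by rewrite ev_cat ev_winv => /(congr1 (mulg^~ (ev h v))); rewrite mulgKV mul1g.
Qed.

Definition word_of (G : groupType) (J : Type) (a : J -> G) (g : G) : word J :=
  if pselect (gen a g) is left gP then s2val (cid2 gP) else [::].

Lemma word_ofK (G : groupType) (J : Type) (a : J -> G) g :
  gen a g -> ev a (word_of a g) = g.
Proof. by rewrite /word_of; case: pselect => // gP _; case: (cid2 gP). Qed.

(** The homomorphism that extends [h], as a total function whose values outside
    [gen a] are irrelevant. *)
Definition ext (G H : groupType) (J : Type) (a : J -> G) (h : J -> H) (g : G) :
  H := ev h (word_of a g).

Section Ext.
Variables (G H : groupType) (J : Type) (a : J -> G) (h : J -> H).
Hypothesis fa : free a.

Lemma extE w : ext a h (ev a w) = ev h w.
Proof. by apply: (free_eq h fa); apply: word_ofK; apply: genP. Qed.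

Lemma ext_gen j : ext a h (a j) = h j.
Proof. by have := extE [:: (false, j)]; rewrite !ev1. Qed.

Lemma extM x y : gen a x -> gen a y -> ext a h (x * y) = ext a h x * ext a h y.
Proof. by move=> [u _ <-] [v _ <-]; rewrite -ev_cat !extE ev_cat. Qed.

Lemma extV x : gen a x -> ext a h x^-1 = (ext a h x)^-1.
Proof. by move=> [u _ <-]; rewrite -ev_winv !extE ev_winv. Qed.

Lemma ext_ev (I : Type) (s : I -> G) w : (forall i, gen a (s i)) ->
  ext a h (ev s w) = ev (fun i => ext a h (s i)) w.
Proof.
move=> sa; have gs v : gen a (ev s v) by apply: subgroup_ev => //; apply: gen_subgroup.
elim: w => [|[b i] w IH]; first by rewrite (extE [::]).
rewrite !ev_cons extM ?IH //; last by have := gs [:: (b, i)]; rewrite ev1.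
by case: b => //=; rewrite extV.
Qed.

End Ext.

(** A word that is trivial on the family [ev a (s i)] is trivial on all families
    of the form [ev h' (s i)], which by assumption are all families. *)
Lemma free_subst (G : groupType) (J I : Type) (a : J -> G) (s : I -> word J) :
  free a ->
  (forall (H : groupType) (h : I -> H),
     exists h' : J -> H, forall i, ev h' (s i) = h i) ->
  free (fun i => ev a (s i)).
Proof.
move=> fa sP w; rewrite -ev_wsub => /fa e H h; have [h' h'P] := sP H h.
by rewrite -(eq_ev h'P) -ev_wsub.
Qed.

(** * Permutation representations prescribed along an immersed graph *)

Lemma extend_perm (T : finType) (P : seq (T * T)) :
  uniq (unzip1 P) -> uniq (unzip2 P) ->
  exists s : {perm T}, forall p, p \in P -> s p.1 = p.2.
Proof.
elim: P => [|[x y] P IH] /=; first by exists 1.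
move=> /andP[xP u1] /andP[yP u2]; have [s sP] := IH u1 u2.
exists (s * tperm (s x) y) => p; rewrite inE permM => /orP[/eqP-> /=|pP].
  by rewrite tpermL.
rewrite sP //; apply: tpermD.
  apply: contraNneq xP; rewrite -(sP _ pP) => /perm_inj ->.
  exact: (map_f fst pP).
by apply: contraNneq yP => ->; apply: (map_f snd pP).
Qed.

(** The edge [i] runs from [A i] to [B i] with label [l i]. The last hypothesis
    says that no edge is followed by one that cancels it; each letter is then a
    partial injection, and these extend to permutations of a finite set. *)
Lemma extend_action (T I : finType) (J : eqType) (A B : I -> T)
    (l : I -> bool * J) :
  injective A -> injective B -> (forall i k, B i = A k -> l k != linv (l i)) ->
  exists p : J -> {perm T}, forall i, sgn (l i).1 (p (l i).2) (A i) = B i.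
Proof.
move=> Ai Bi lP.
pose P j := [seq if (l i).1 then (B i, A i) else (A i, B i)
               | i <- enum I & (l i).2 == j].
have lE i : l i = ((l i).1, (l i).2) by case: (l i).
have u j : uniq (unzip1 (P j)) /\ uniq (unzip2 (P j)).
  rewrite /unzip1 /unzip2 -!map_comp; split.
  - rewrite map_inj_in_uniq; first exact/filter_uniq/enum_uniq.
    move=> i k.
    rewrite !mem_filter => /andP[/eqP li _] /andP[/eqP lk _] /=.
    case Ei: (l i).1; case Ek: (l k).1 => //=.
    + exact: Bi.
    + by move=> /lP; rewrite (lE i) (lE k) li lk Ei Ek eqxx.
    + by move=> /esym/lP; rewrite (lE i) (lE k) li lk Ei Ek eqxx.
    + exact: Ai.
  - rewrite map_inj_in_uniq; first exact/filter_uniq/enum_uniq.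
    move=> i k.
    rewrite !mem_filter => /andP[/eqP li _] /andP[/eqP lk _] /=.
    case Ei: (l i).1; case Ek: (l k).1 => //=.
    + exact: Ai.
    + by move=> /esym/lP; rewrite (lE i) (lE k) li lk Ei Ek eqxx.
    + by move=> /lP; rewrite (lE i) (lE k) li lk Ei Ek eqxx.
    + exact: Bi.
have [p pP] : {p : J -> {perm T} & forall j q, q \in P j -> p j q.1 = q.2}.
  apply: (@choice _ _ (fun j (s : {perm T}) => forall q, q \in P j -> s q.1 = q.2)) => j.
  by case: (u j) => u1 u2; apply: extend_perm.
exists p => i.
have : (if (l i).1 then (B i, A i) else (A i, B i)) \in P (l i).2.
  by apply/mapP; exists i => //; rewrite mem_filter eqxx mem_enum.
move=> /pP; case: (l i).1 => //= <-; exact: permK.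
Qed.

(** A reduced word labels an embedded path, and so acts non-trivially in some
    finite permutation representation. *)
Lemma free_reduced (G : groupType) (J : eqType) (a : J -> G) w :
  free a -> reduced w -> ev a w = 1 -> w = [::].
Proof.
move=> fa rw e; case: (posnP (size w)) => [/size0nil//|w0].
have [x0 _] : exists x0 : bool * J, true by case: (w) w0 => // x; exists x.
have [p pP] : exists p : J -> {perm 'I_(size w).+1}, forall i : 'I_(size w),
    sgn (nth x0 w i).1 (p (nth x0 w i).2) (widen_ord (leqnSn _) i) = lift ord0 i.
  apply: extend_action.
  - by move=> i k /(congr1 val) /= e'; apply: val_inj.
  - exact: lift_inj.
  move=> i k /(congr1 val) /=; rewrite /bump /= add1n => ik.
  have kw := ltn_ord k; rewrite -ik in kw *.
  by have /(sortedP x0)/(_ _ kw) := rw.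
have pth k : k <= size w -> ev p (take k w) ord0 = inord k.
  elim: k => [|k IH] kw; first by rewrite take0 perm1; apply/val_inj; rewrite /= inordK.
  rewrite (take_nth x0) // ev_rcons permM IH ?(ltnW kw) //.
  have := pP (Ordinal kw); rewrite /=.
  have -> : widen_ord (leqnSn (size w)) (Ordinal kw) = inord k.
    by apply/val_inj; rewrite /= inordK // ltnS ltnW.
  by move=> ->; apply/val_inj; rewrite /= /bump /= add1n inordK.
have := pth _ (leqnn _); rewrite take_size (fa _ e _ p) perm1.
move=> /(congr1 val) /=; rewrite inordK // => E.
by rewrite -E in w0.
Qed.

Lemma free_reduce (G : groupType) (J : eqType) (a : J -> G) w :
  free a -> ev a w = 1 -> reduce w = [::].
Proof.
by move=> fa e; apply: (free_reduced fa (reduce_reduced w)); rewrite ev_reduce.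
Qed.

(** * Framings and the commensurator classes between them *)

Section Framings.
Variable F : groupType.
Implicit Types (c d : Comm F) (A B : set F).

(** Framings serve as coordinates for virtual isomorphisms: two of them with the
    same index type determine a class, by [moves_ex] and [moves_uniq]. *)
Definition framing (J : Type) (a : J -> F) : Prop :=
  free a /\ fi_subgroup (gen a).

Definition moves (J : Type) c (a b : J -> F) : Prop :=
  exists2 phi : virt_iso F, comm_class phi = c &
    forall j, vdom phi (a j) /\ phi (a j) = b j.

Definition carries c A B : Prop :=
  exists2 phi : virt_iso F, comm_class phi = c &
    A `<=` vdom phi /\ [set phi x | x in A] = B.

Lemma vfun_ev (J : Type) (phi : virt_iso F) (a b : J -> F) :
  (forall j, vdom phi (a j) /\ phi (a j) = b j) ->
  forall w, vdom phi (ev a w) /\ phi (ev a w) = ev b w.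
Proof.
move=> ab; elim=> [|[e j] w [IH1 IH2]].
  by split; [apply: subgroup1 (vdom_gr phi)|apply: vfun1].
have [aj ajE] := ab j.
have se : vdom phi (sgn e (a j)) /\ phi (sgn e (a j)) = sgn e (phi (a j)).
  by case: e => //=; split; [apply: (subgroupV (vdom_gr phi))|rewrite vfunV].
rewrite !ev_cons /= -ajE; case: se => se1 <-.
by split; [apply: (subgroupM (vdom_gr phi))|rewrite vfunM ?IH2].
Qed.

Lemma moves_mul (J : Type) c d (a b e : J -> F) :
  moves c a b -> moves d b e -> moves (c * d) a e.
Proof.
move=> [f <- fP] [g <- gP]; exists (vcomp f g); first by rewrite comm_classM.
move=> j; have [f1 f2] := fP j; have [g1 g2] := gP j.
split; last by rewrite /= f2 g2.
by split=> //=; rewrite f2; split=> //; rewrite -f2; apply: vfun_cod.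
Qed.

Lemma moves_inv (J : Type) c (a b : J -> F) : moves c a b -> moves c^-1 b a.
Proof.
move=> [f <- fP]; exists (vinv f); first by rewrite comm_classV.
move=> j; have [f1 <-] := fP j.
by split; [apply: vfun_cod|apply: vfunK].
Qed.

Lemma moves_subst (I J : Type) c (a b : J -> F) (s : I -> word J) :
  moves c a b -> moves c (fun i => ev a (s i)) (fun i => ev b (s i)).
Proof. by move=> [f fc fP]; exists f => // i; apply: vfun_ev. Qed.

Lemma moves_ext (J : Type) c (a b a' b' : J -> F) :
  a =1 a' -> b =1 b' -> moves c a b -> moves c a' b'.
Proof. by move=> aa bb [f fc fP]; exists f => // j; rewrite -aa -bb. Qed.

Lemma moves1 (J : Type) (a : J -> F) : moves 1 a a.
Proof. by exists (vid F). Qed.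

Lemma moves_uniq (J : Type) c d (a b : J -> F) :
  fi_subgroup (gen a) -> moves c a b -> moves d a b -> c = d.
Proof.
move=> fia [f <- fP] [g <- gP]; apply/comm_classP; exists (gen a); split=> //.
  by move=> _ [w _ <-]; split; case: (vfun_ev fP w); case: (vfun_ev gP w).
move=> _ [w _ <-]; case: (vfun_ev fP w) => _ ->.
by case: (vfun_ev gP w) => _ ->.
Qed.

Lemma moves_gen (J : Type) c (a b : J -> F) :
  moves c a b -> carries c (gen a) (gen b).
Proof.
move=> [f <- fP]; exists f => //; split.
  by move=> _ [w _ <-]; case: (vfun_ev fP w).
apply/seteqP; split=> [_ [_ [w _ <-] <-]|_ [w _ <-]].
  by case: (vfun_ev fP w) => _ ->; apply: genP.
by exists (ev a w); [apply: genP|case: (vfun_ev fP w)].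
Qed.

(** A subgroup cut out by a condition on words in one basis is carried to the
    subgroup cut out by the same condition in the other. *)
Lemma moves_words (J : Type) c (a b : J -> F) (P : word J -> Prop) :
  moves c a b ->
  carries c [set ev a w | w in P] [set ev b w | w in P].
Proof.
move=> [f <- fP]; exists f => //; split.
  by move=> _ [w _ <-]; case: (vfun_ev fP w).
apply/seteqP; split=> [_ [_ [w Pw <-] <-]|_ [w Pw <-]].
  by case: (vfun_ev fP w) => _ ->; exists w.
by exists (ev a w); [exists w|case: (vfun_ev fP w)].
Qed.

Lemma carries_mul c d A B E : carries c A B -> carries d B E ->
  carries (c * d) A E.
Proof.
move=> [f <- [sA fA]] [g <- [sB gB]]; exists (vcomp f g).
  by rewrite comm_classM.
split=> [x Ax|].
  split; first exact: sA.
  split; first by apply/vfun_cod/sA.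
  by apply: sB; rewrite -fA; exists x.
rewrite -gB -fA; apply/seteqP; split=> [_ [x Ax <-]|_ [_ [x Ax <-] <-]].
  by exists (f x) => //; exists x.
by exists x.
Qed.

Lemma carries_inv c A B : carries c A B -> carries c^-1 B A.
Proof.
move=> [f <- [sA <-]]; exists (vinv f); first by rewrite comm_classV.
split; first by move=> _ [x Ax <-]; apply/vfun_cod/sA.
apply/seteqP; split=> [_ [_ [x Ax <-] <-]|x Ax].
  by rewrite vfunK //; apply: sA.
by exists (f x); [exists x|rewrite vfunK //; apply: sA].
Qed.

Lemma carries_fi c A B : carries c A B -> fi_subgroup A -> fi_subgroup B.
Proof.
move=> [f _ [sA <-]] fiA; have := fi_subgroup_image f fiA; congr fi_subgroup.
by rewrite (_ : vdom f `&` A = A) //; apply/setIidPr.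
Qed.

Lemma moves_framing (J : Type) c (a b : J -> F) :
  moves c a b -> framing a -> framing b.
Proof.
move=> cab [fa fia]; split; last exact: carries_fi (moves_gen cab) fia.
case: cab => [f _ fP] w e; apply: fa; have [fw1 fw2] := vfun_ev fP w.
apply: (@vfun_inj _ f) => //; last by rewrite fw2 vfun1.
exact: subgroup1 (vdom_gr f).
Qed.

Lemma framings_bij (J : Type) (a b : J -> F) : framing a -> framing b ->
  set_bij (gen a) (gen b) (ext a b).
Proof.
move=> [fa _] [fb _]; split=> [_ [w _ <-]|x y|_ [w _ <-]].
- by rewrite extE //; apply: genP.
- rewrite !inE => -[u _ <-] [v _ <-]; rewrite !extE // => e.
  exact: free_eq fb e.
- by exists (ev a w); [apply: genP|rewrite extE].
Qed.

Lemma framings_morph (J : Type) (a b : J -> F) : framing a ->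
  {in gen a &, {morph ext a b : x y / x * y}}.
Proof. by move=> [fa _] x y; rewrite !inE => ax ay; rewrite extM. Qed.

Lemma moves_ex (J : Type) (a b : J -> F) : framing a -> framing b ->
  exists c, moves c a b.
Proof.
move=> fra frb; have [fa fia] := fra; have [_ fib] := frb.
pose f := VirtIso fia fib (framings_bij fra frb) (framings_morph b fra).
by exists (comm_class f), f => // j; split; [apply: gen_gen|apply: ext_gen].
Qed.

Lemma carries_moves (J : Type) c A B (a : J -> F) : carries c A B -> gen a = A ->
  exists2 b, moves c a b & gen b = B.
Proof.
move=> [f fc [sA fA]] aA.
have fP j : vdom f (a j) /\ f (a j) = f (a j).
  by split=> //; apply: sA; rewrite -aA; apply: gen_gen.
exists (fun j => f (a j)); first by exists f.
rewrite -fA -aA; apply/seteqP; split=> [_ [w _ <-]|_ [_ [w _ <-] <-]].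
  by exists (ev a w); [apply: genP|case: (vfun_ev fP w)].
by case: (vfun_ev fP w) => _ ->; apply: genP.
Qed.

(** ** Conjugations *)

Fact conj_bij (g : F) : set_bij [set: F] [set: F] (conjg^~ g).
Proof.
split=> // [x y _ _|y _]; first exact: conjg_inj.
by exists (y ^ g^-1) => //; rewrite conjgKV.
Qed.

Definition conj_iso (g : F) : virt_iso F :=
  VirtIso (@fi_subgroupT F) (@fi_subgroupT F) (conj_bij g)
    (fun x y _ _ => conjMg x y g).

Definition inn (g : F) : Comm F := comm_class (conj_iso g).

Lemma innM g h : inn (g * h) = inn g * inn h.
Proof.
rewrite /inn comm_classM; apply/comm_classP; apply: virt_equiv_sym.
by apply: virt_equiv_ext => // x _; rewrite /= conjgM.
Qed.

Lemma innV g : inn g^-1 = (inn g)^-1.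
Proof.
apply: (mulgI (inn g)); rewrite -innM !mulgV; apply/comm_classP.
by apply: virt_equiv_ext => // x _ /=; rewrite conjg1.
Qed.

Lemma moves_inn (J : Type) (a : J -> F) g : moves (inn g) a (fun j => a j ^ g).
Proof. by exists (conj_iso g). Qed.

Lemma inn_conj (phi : virt_iso F) g : vdom phi g ->
  inn g ^ comm_class phi = inn (phi g).
Proof.
move=> phig; rewrite conjgE /inn comm_classV (comm_classM (conj_iso g)) (comm_classM (vinv phi)).
apply/comm_classP; apply: virt_equiv_ext => // x [/= cx [_ [_ [_ d2]]]].
rewrite /= in d2 *; have dx : vdom phi (vinv phi x).
  exact: (@vfun_cod _ (vinv phi)).
have dV : vdom phi g^-1 by apply: (subgroupV (vdom_gr phi)).
rewrite /= !conjgE !vfunM ?vfunV //.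
  by rewrite [phi (_ x)](vinvK cx).
by apply: (subgroupM (vdom_gr phi)).
Qed.

End Framings.

(** * Stabilizers and Schreier bases *)

(** The map [theta] separates the cosets of [A] in [H]. *)
Lemma fi_subgroup_of_finite (G : groupType) (H A : set G) (T : finType)
    (theta : G -> T) : fi_subgroup H -> is_subgroup A ->
  (forall x y, H x -> H y -> theta x = theta y -> A (x^-1 * y)) ->
  fi_subgroup A.
Proof.
move=> /fi_subgroupP[gH [s sP]] gA AP; apply/fi_subgroupP; split=> //.
have [r rP] : {r : T -> G & forall k x, H x -> theta x = k ->
    H (r k) /\ theta (r k) = k}.
  apply: (@choice _ _ (fun k (y : G) => forall x, H x -> theta x = k ->
    H y /\ theta y = k)) => k.
  have [[z [Hz zk]]|nP] := pselect (exists z, H z /\ theta z = k).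
    by exists z.
  by exists 1 => x Hx xk; case: nP; exists x.
exists [seq y * r k | y <- s, k <- enum T] => x.
have [y ys Hyx] := sP x; have [Hr rE] := rP _ _ Hyx erefl.
exists (y * r (theta (y^-1 * x))).
  by apply/allpairsP; exists (y, theta (y^-1 * x)); rewrite ys mem_enum.
by rewrite invgM -mulgA; apply: AP.
Qed.

Definition stab (G : groupType) (J : Type) (T : finType) (y : J -> G)
    (p : J -> {perm T}) (o : T) : set G :=
  [set ev y w | w in [set w | ev p w o = o]].

Section Stab.
Variables (G : groupType) (J : Type) (T : finType) (y : J -> G).
Variables (p : J -> {perm T}) (o : T).

Lemma stab_subgroup : is_subgroup (stab y p o).
Proof.
apply/is_subgroupP; split; first by exists [::] => //=; rewrite perm1.
move=> _ _ [u /= up <-] [v /= vp <-]; exists (u ++ winv v).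
  by rewrite /= ev_cat ev_winv permM up -[in LHS]vp permK.
by rewrite ev_cat ev_winv.
Qed.

Lemma stab_sub : stab y p o `<=` gen y.
Proof. by move=> _ [w _ <-]; apply: genP. Qed.

End Stab.

Lemma stab_fi (F : groupType) (J : Type) (T : finType) (y : J -> F)
    (p : J -> {perm T}) (o : T) : framing y -> fi_subgroup (stab y p o).
Proof.
move=> [fy fiy]; apply: (fi_subgroup_of_finite (theta := ext y p) fiy).
  exact: stab_subgroup.
move=> _ _ [u _ <-] [v _ <-]; rewrite !extE // => e.
by exists (winv u ++ v); rewrite /= ?ev_cat ?ev_winv // e mulVg perm1.
Qed.

Section Schreier.
Variables (J : eqType) (T : finType) (p : J -> {perm T}).
Implicit Types (v : T) (w : word J).

(** An edge is named by its origin for the positive orientation, whichever way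
    it is crossed. *)
Fixpoint edges v w : seq (T * J) :=
  if w is (b, j) :: w' then
    let v' := sgn b (p j) v in
    (if b then (v', j) else (v, j)) :: edges v' w'
  else [::].

Lemma edges_cat v w1 w2 :
  edges v (w1 ++ w2) = edges v w1 ++ edges (ev p w1 v) w2.
Proof.
elim: w1 v => [|[b j] w1 IH] v /=; first by rewrite perm1.
by rewrite IH permM.
Qed.

(** A spanning tree of the Schreier graph, rooted at [o]: the word [t v] labels
    the path in the tree from [o] to [v]. The last condition says that an edge of
    the tree joins a vertex to its parent, in one of the two directions. *)
Definition schreier_tree (o : T) (t : T -> word J) (Tr : pred (T * J)) : Prop :=
  [/\ forall v, ev p (t v) o = v, t o = [::],
      forall v e, e \in edges o (t v) -> Tr e &
      forall v j, Tr (v, j) ->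
        t (p j v) = rcons (t v) (false, j) \/
        t v = rcons (t (p j v)) (true, j)].

Section Cocycle.
Variables (H : groupType) (h : T * J -> H).

(** The value on a path of the labelling [h] of the edges; on words this is a
    crossed homomorphism, i.e. the component in a power of [H] of a
    homomorphism to the wreath product of [H] with the permutations of [T]. *)
Fixpoint coc v w : H :=
  if w is (b, j) :: w' then
    let v' := sgn b (p j) v in
    sgn b (h (if b then v' else v, j)) * coc v' w'
  else 1.

Lemma coc_cat v w1 w2 : coc v (w1 ++ w2) = coc v w1 * coc (ev p w1 v) w2.
Proof.
elim: w1 v => [|[b j] w1 IH] v /=; first by rewrite perm1 mul1g.
by rewrite IH permM mulgA.
Qed.

Lemma coc_cons_red v x w : coc v (cons_red x w) = coc v (x :: w).
Proof.
case: w => [//|z w]; rewrite [cons_red _ _]/=; case: eqVneq => // ->.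
by case: x => -[] j /=; rewrite ?permK ?permKV mulgA ?mulgV ?mulVg mul1g.
Qed.

Lemma coc_reduce v w : coc v (reduce w) = coc v w.
Proof.
by elim: w v => [//|[b j] w IH] v; rewrite coc_cons_red /= IH.
Qed.

Lemma coc_winv v w : coc (ev p w v) (winv w) = (coc v w)^-1.
Proof.
apply: (mulgI (coc v w)); rewrite mulgV -coc_cat; elim: w v => [//|[b j] w IH] v.
rewrite -cat1s winv_cat -catA [w ++ _]catA coc_cat (coc_cat _ (w ++ winv w)).
rewrite IH mul1g ev_cat ev_winv mulgV perm1 /=.
rewrite !mulg1.
by case: b => /=; rewrite ?permK ?permKV ?mulgV ?mulVg.
Qed.

Lemma coc_trivial v w :
  (forall e, e \in edges v w -> h e = 1) -> coc v w = 1.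
Proof.
elim: w v => [//|[b j] w IH] v /= hP.
rewrite IH => [|e ew]; last by apply: hP; rewrite inE ew orbT.
rewrite mulg1; have /hP := mem_head (if b then (sgn b (p j) v, j) else (v, j))
  (edges (sgn b (p j) v) w).
by case: b hP => hP /= ->; rewrite ?invg1.
Qed.

End Cocycle.

Variables (o : T) (t : T -> word J) (Tr : pred (T * J)).
Hypothesis treeP : schreier_tree o t Tr.

Definition schreier_word (e : T * J) : word J :=
  t e.1 ++ (false, e.2) :: winv (t (p e.2 e.1)).

Lemma schreier_word_loop e : ev p (schreier_word e) o = o.
Proof.
have [tP _ _ _] := treeP; rewrite ev_cat ev_cons ev_winv !permM tP /=.
by apply: (perm_inj (s := ev p (t (p e.2 e.1)))); rewrite permKV tP.
Qed.

Lemma coc_schreier_word (H : groupType) (h : T * J -> H) e :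
  (forall e', Tr e' -> h e' = 1) -> coc h o (schreier_word e) = h e.
Proof.
have [tP _ tT _] := treeP => hT.
have tr v : coc h o (t v) = 1 by apply: coc_trivial => e' /tT/hT.
rewrite coc_cat tr mul1g tP /=; have := coc_winv h o (t (p e.2 e.1)).
by rewrite tP tr invg1 => ->; rewrite mulg1; case: e.
Qed.

Variables (G : groupType) (y : J -> G).

Definition schreier_basis (e : {e | ~~ Tr e}) : G :=
  ev y (schreier_word (val e)).

(** A labelling that is trivial on the tree has cocycle [h e] along the loop
    through [e], and on loops at the root the cocycle is multiplicative; so the
    loops can be sent to arbitrary elements of any group. *)
Lemma schreier_basis_free : free y -> free schreier_basis.
Proof.
move=> fy W; rewrite -(@ev_wsub _ _ _ (fun e => schreier_word (val e))).
move=> /(free_reduce fy) rW H h.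
pose hh e := if insub e is Some e' then h e' else 1.
have hT e : Tr e -> hh e = 1 by move=> Te; rewrite /hh insubF // Te.
suff E : coc hh o (wsub (fun e => schreier_word (val e)) W) = ev h W.
  by rewrite -E -coc_reduce rW.
elim: W {rW} => [//|[b e] W IH]; rewrite /wsub /= coc_cat -/(wsub _ W).
have lp : ev p (schreier_word (val e)) o = o by apply: schreier_word_loop.
have ce : coc hh o (schreier_word (val e)) = h e.
  by rewrite coc_schreier_word // /hh valK.
case: b => /=; last by rewrite ce lp IH.
have := coc_winv hh o (schreier_word (val e)); rewrite lp ce => ->.
suff -> : ev p (winv (schreier_word (val e))) o = o by rewrite IH.
by apply: (perm_inj (s := ev p (schreier_word (val e)))); rewrite ev_winv permKV lp.
Qed.

(** Returning to the root along the tree after each letter writes a loop as a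
    product of basis elements and their inverses. *)
Lemma schreier_basis_gen : gen schreier_basis = stab y p o.
Proof.
apply/seteqP; split.
  apply: gen_sub => [|e]; first exact: stab_subgroup.
  by exists (schreier_word (val e)) => //; apply: schreier_word_loop.
have [tP t0 _ tT] := treeP; have gS := gen_subgroup schreier_basis.
have step v j :
    gen schreier_basis (ev y (t v) * y j * (ev y (t (p j v)))^-1).
  case E: (Tr (v, j)).
    rewrite (_ : _ * _ = 1); first exact: subgroup1 gS.
    by case: (tT _ _ E) => ->; rewrite ev_rcons /= ?mulgKV mulgV.
  have := gen_gen schreier_basis (exist _ (v, j) (negbT E)).
  by rewrite /schreier_basis /= ev_cat ev_cons ev_winv mulgA.
have walk w v :
    gen schreier_basis (ev y (t v) * ev y w * (ev y (t (ev p w v)))^-1).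
  elim: w v => [|[b j] w IH] v; first by rewrite perm1 mulg1 mulgV; apply: subgroup1 gS.
  have stepb : gen schreier_basis
      (ev y (t v) * sgn b (y j) * (ev y (t (sgn b (p j) v)))^-1).
    case: b => /=; last exact: step.
    have := subgroupV gS (step ((p j)^-1 v) j).
    by rewrite permKV !invgM invgK !mulgA.
  have := subgroupM gS stepb (IH (sgn b (p j) v)).
  by rewrite (ev_cons p) (ev_cons y) permM !mulgA mulgKV.
move=> _ [w /= wo <-]; have := walk w o.
by rewrite wo t0 /= mul1g invg1 mulg1.
Qed.

End Schreier.

Lemma schreier_framing (F : groupType) (J : eqType) (T : finType) (o : T)
    (p : J -> {perm T}) (t : T -> word J) (Tr : pred (T * J)) (y : J -> F) :
  framing y -> schreier_tree p o t Tr -> framing (schreier_basis p t (Tr := Tr) y).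
Proof.
move=> fry tP; split; first by apply: schreier_basis_free tP _ _ _; case: fry.
by rewrite (schreier_basis_gen tP); apply: stab_fi.
Qed.

Section TreeExists.
Variables (J : finType) (T : finType) (p : J -> {perm T}) (o : T).
Hypothesis trans : forall v, exists w, ev p w o = v.

Let partial (V : {set T}) (t : T -> word J) (Tr : {set T * J}) : Prop :=
  [/\ o \in V /\ t o = [::], forall v, v \in V -> ev p (t v) o = v,
      forall v e, v \in V -> e \in edges p o (t v) -> e \in Tr,
      forall v j, (v, j) \in Tr -> [/\ v \in V, p j v \in V &
        t (p j v) = rcons (t v) (false, j) \/
        t v = rcons (t (p j v)) (true, j)] &
      #|Tr|.+1 = #|V|].

Let crossing (V : {set T}) w v : v \in V -> ev p w v \notin V ->
  exists2 u, u \in V & exists x : bool * J, sgn x.1 (p x.2) u \notin V.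
Proof.
elim: w v => [|[b j] w IH] v vV /=; first by rewrite perm1 vV.
rewrite permM => wV; case: (boolP (sgn b (p j) v \in V)) => [/IH|nV]; first exact.
by exists v => //; exists (b, j).
Qed.

(** The tree is grown edge by edge: while a vertex is missing, the path to it
    leaves the part already reached. *)
Lemma schreier_tree_exists : exists t (Tr : {set T * J}),
  schreier_tree p o t [in Tr] /\ #|Tr|.+1 = #|T|.
Proof.
have grow k : k < #|T| -> exists V t Tr, partial V t Tr /\ #|V| = k.+1.
  elim: k => [|k IH] kT.
    exists [set o]%SET, (fun=> [::]), finset.set0; split; last by rewrite cards1.
    split.
    - by rewrite inE.
    - by move=> v; rewrite inE => /eqP->; rewrite perm1.
    - by [].
    - by move=> v j; rewrite finset.in_set0.
    - by rewrite cards0 cards1.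
  have [V [t [Tr [[[oV t0] tV eV TV cT] cV]]]] := IH (ltnW kT).
  have [z zV] : exists z, z \notin V.
    apply/existsP; rewrite -negb_forall; apply/negP => /forallP aV.
    move: kT; rewrite -cV ltnNge => /negP; apply.
    by rewrite -cardsT; apply/subset_leq_card/fintype.subsetP => z _; apply: aV.
  have [w wz] := trans z.
  have [|u uV [x xV]] := crossing (w := w) oV; first by rewrite wz.
  set r := sgn x.1 (p x.2) u in xV.
  pose e := if x.1 then (r, x.2) else (u, x.2).
  have eE : [/\ e = (r, x.2), p x.2 r = u & x = (true, x.2)] \/
            [/\ e = (u, x.2), p x.2 u = r & x = (false, x.2)].
    rewrite /e /r; case: (x) => -[] i /=; [left|right]; split=> //.
    exact: permKV.
  have neq v : v \in V -> v == r = false.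
    by move=> vV; apply: contraNF xV => /eqP <-.
  exists (r |: V)%SET, (fun v => if v == r then rcons (t u) x else t v), (e |: Tr)%SET.
  split; last by rewrite cardsU1 xV cV.
  have eu : edges p o (rcons (t u) x) = rcons (edges p o (t u)) e.
    by rewrite -!cats1 edges_cat tV // /e /r; case: (x) => -[].
  split.
  - by rewrite inE oV orbT neq.
  - move=> v; rewrite !inE; case: eqVneq => [-> _|_ /= /tV//].
    by rewrite ev_rcons permM tV.
  - move=> v e'; rewrite !inE; case: eqVneq => [-> _|_ /= vV /(eV _ _ vV)->].
      rewrite eu mem_rcons inE => /orP[->//|/(eV _ _ uV)->].
      by rewrite orbT.
    by rewrite orbT.
  - move=> v j; rewrite !inE => /orP[/eqP|/TV[vV pV tE]]; last first.
      by rewrite vV pV !orbT !neq.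
    case: eE => -[eE pE xE]; rewrite eE => -[-> ->]; rewrite pE eqxx uV orbT neq //.
      by split=> //; right; rewrite -xE.
    by split=> //; left; rewrite -xE.
  - rewrite !cardsU1 xV -cT; suff -> : e \notin Tr by [].
    apply/negP; case: eE => -[-> pE _] /TV[]; first by rewrite (negPf xV).
    by rewrite pE (negPf xV).
have T0 : 0 < #|T| by apply/card_gt0P; exists o.
have [V [t [Tr [[[oV t0] tV eV TV cT] cV]]]] := grow #|T|.-1 ltac:(by rewrite prednK).
have VT v : v \in V.
  apply/negPn/negP => vV; have := max_card (mem (v |: V)%SET).
  by rewrite cardsU1 vV cV prednK // ltnn.
exists t, Tr; split; last by rewrite cT cV prednK.
split=> // [v|v e|v j /TV[]//]; first exact: tV.
exact: eV.
Qed.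

End TreeExists.

Lemma card_nontree (T J : finType) (Tr : {set T * J}) : #|Tr|.+1 = #|T| ->
  #|{: {e : T * J | e \notin Tr}}| + #|T| = (#|T| * #|J|).+1.
Proof.
move=> cT; rewrite card_sig -cT addnS; congr _.+1.
have := cardC (mem Tr); rewrite card_prod cT => <-.
by rewrite addnC.
Qed.

(** * Reindexing *)

Lemma gen_eq (G : groupType) (I J : Type) (a : I -> G) (b : J -> G) :
  (forall i, gen b (a i)) -> (forall j, gen a (b j)) -> gen a = gen b.
Proof.
by move=> ab ba; apply/seteqP; split; apply: gen_sub => //; apply: gen_subgroup.
Qed.

(** The substitutions being inverse to each other in every group, any family
    [h] is the image under [s] of the family [ev h (s' j)]; so freeness is
    inherited, and each family generates the other. *)
Lemma framing_subst (F : groupType) (I J : Type) (a : J -> F) (s : I -> word J)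
    (s' : J -> word I) :
  framing a ->
  (forall (H : groupType) (h : J -> H) j, ev (fun i => ev h (s i)) (s' j) = h j) ->
  (forall (H : groupType) (h : I -> H) i, ev (fun j => ev h (s' j)) (s i) = h i) ->
  framing (fun i => ev a (s i)) /\ gen (fun i => ev a (s i)) = gen a.
Proof.
move=> [fa fia] sK s'K; have E : gen (fun i => ev a (s i)) = gen a.
  apply: gen_eq => [i|j]; first exact: genP.
  by exists (s' j); rewrite // sK.
split=> //; split; last by rewrite E.
by apply: free_subst => // H h; exists (fun j => ev h (s' j)).
Qed.

Lemma framing_reindex (F : groupType) (I J : Type) (a : J -> F) (f : I -> J) :
  bijective f -> framing a -> framing (a \o f) /\ gen (a \o f) = gen a.
Proof.
move=> [g fK gK] fra.
have [||] := @framing_subst F I J a (fun i => [:: (false, f i)])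
  (fun j => [:: (false, g j)]) fra.
- by move=> H h j; rewrite ?ev1 /= ?ev1 /= ?mulg1 gK.
- by move=> H h i; rewrite ?ev1 /= ?ev1 /= ?mulg1 fK.
have E : (fun i => ev a [:: (false, f i)]) = a \o f.
  by apply/funext => i; rewrite ev1.
by rewrite E.
Qed.

Lemma card_bij (I J : finType) : #|I| = #|J| -> exists f : I -> J, bijective f.
Proof.
move=> e; exists (fun i => enum_val (cast_ord e (enum_rank i))).
exists (fun j => enum_val (cast_ord (esym e) (enum_rank j))) => x.
  by rewrite enum_valK cast_ordK enum_rankK.
by rewrite enum_valK cast_ordKV enum_rankK.
Qed.

Lemma card_bij2 (I J : finType) (i1 i2 : I) (j1 j2 : J) : #|I| = #|J| ->
  i1 != i2 -> j1 != j2 -> exists f : I -> J, [/\ bijective f, f i1 = j1 & f i2 = j2].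
Proof.
move=> /card_bij[f bf] ni nj.
pose s1 := tperm (f i1) j1; pose s2 := tperm (s1 (f i2)) j2.
exists (fun i => s2 (s1 (f i))); have fi := bij_inj bf; split.
- have [g fK gK] := bf; exists (fun j => g (s1^-1 (s2^-1 j))) => x.
    by rewrite !permK fK.
  by rewrite gK !permKV.
- rewrite /s2 /s1 tpermL; apply: tpermD; last by rewrite eq_sym.
  by rewrite -{2}(tpermL (f i1) j1) inj_eq ?inj_eq // ?[i2 == _]eq_sym //; apply: perm_inj.
- by rewrite /s2 tpermL.
Qed.

(** * Cyclic covers *)

Section Necklace.
Variables (Z : finType) (q : nat).

(** The basis of the kernel of the map to the cyclic group of order [q] which
    sends the first generator to a generator and the other ones to [1]. *)
Definition neck_word (k : option ('I_q * Z)) : word (option Z) :=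
  if k is Some (i, z) then
    nseq i (false, None) ++ (false, Some z) :: winv (nseq i (false, None))
  else nseq q (false, None).

Definition neck (G : groupType) (y : option Z -> G) (k : option ('I_q * Z)) : G :=
  ev y (neck_word k).

Lemma neck_None (G : groupType) (y : option Z -> G) : neck y None = y None ^+ q.
Proof. by rewrite /neck /= ev_nseq. Qed.

Lemma neck_Some (G : groupType) (y : option Z -> G) i z :
  neck y (Some (i, z)) = y None ^+ i * y (Some z) * (y None ^+ i)^-1.
Proof. by rewrite /neck /= ev_cat ev_cons ev_winv ev_nseq mulgA. Qed.

End Necklace.

Section NecklaceBasis.
Variables (Z : finType) (q' : nat).
Let q := q'.+1.

Definition cshift : {perm 'I_q} := perm (@ordS_inj q).

Definition cshift_action (j : option Z) : {perm 'I_q} := if j is Some _ then 1 else cshift.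

Lemma cshiftXE k : (cshift ^+ k) ord0 = inord (k %% q).
Proof.
elim: k => [|k IH].
  by rewrite expg0 perm1; apply/val_inj; rewrite /= mod0n inordK.
rewrite expgSr permM IH permE; apply/val_inj.
by rewrite /= !inordK ?ltn_pmod // -addn1 modnDml addn1.
Qed.

Lemma cshiftX_eq1 k : (cshift ^+ k == 1) = (q %| k).
Proof.
apply/eqP/idP => [rk|/dvdnP[m ->]].
  have := cshiftXE k; rewrite rk perm1 => /(congr1 val) /=.
  by rewrite inordK ?ltn_pmod // => /esym/eqP.
have c (i : 'I_q) : i = (cshift ^+ i) ord0.
  by rewrite cshiftXE modn_small // inord_val.
apply/permP => i; rewrite perm1 {1}(c i) -permM -expgD addnC.
by rewrite cshiftXE modnMDl modn_small // inord_val.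
Qed.

Lemma order_cshift : #[cshift] = q.
Proof.
by apply/eqP; rewrite eqn_dvd order_dvdn cshiftX_eq1 dvdnn -cshiftX_eq1 expg_order eqxx.
Qed.

Let t (v : 'I_q) : word (option Z) := nseq v (false, None).
Let Tr (e : 'I_q * option Z) : bool := (e.2 == None) && (e.1 < q').

Let evt (v : 'I_q) : ev cshift_action (t v) ord0 = v.
Proof. by rewrite ev_nseq cshiftXE modn_small // inord_val. Qed.

Let neck_tree : schreier_tree cshift_action ord0 t Tr.
Proof.
split=> // [v e|v [z|]].
- have : (v : nat) <= q' by rewrite -ltnS.
  rewrite /t; elim: (v : nat) => [//|k IH] kq.
  rewrite -addn1 nseqD edges_cat mem_cat => /orP[/(IH (ltnW kq))//|].
  rewrite ev_nseq cshiftXE mem_seq1 => /eqP ->; rewrite /Tr /= inordK ?ltn_pmod //.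
  by rewrite modn_small // ltnW.
- by rewrite /Tr.
- rewrite /Tr /= => vq; left; rewrite /t permE /= modn_small ?ltnS //.
  by rewrite -cats1 -addn1 nseqD.
Qed.

Let idx (k : option ('I_q * Z)) : 'I_q * option Z :=
  if k is Some (i, z) then (i, Some z) else (ord_max, None).

Let idx_Tr k : ~~ Tr (idx k).
Proof. by case: k => [[i z]|]; rewrite /Tr /= ?ltnn. Qed.

Let idx' (k : option ('I_q * Z)) : {e | ~~ Tr e} := exist _ (idx k) (idx_Tr k).

Let idx'_bij : bijective idx'.
Proof.
exists (fun e => if (val e).2 is Some z then Some ((val e).1, z) else None).
  by case=> [[i z]|].
move=> [[i [z|]] Te]; apply/val_inj => //=.
congr pair; apply/val_inj => /=; apply/eqP; rewrite eqn_leq.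
by move: Te; rewrite /Tr /= -leqNgt => -> /=; rewrite -ltnS.
Qed.

Let neckE (G : groupType) (y : option Z -> G) :
  schreier_basis cshift_action t (Tr := Tr) y \o idx' = neck y.
Proof.
apply/funext => -[[i z]|]; rewrite /schreier_basis /neck /= /schreier_word /=.
  by rewrite perm1.
rewrite !ev_cat !ev_cons ev_winv !ev_nseq permE /= modnn expg0 invg1 mulg1.
by rewrite -expgSr expgS.
Qed.

Lemma neck_gen (G : groupType) (y : option Z -> G) :
  gen (neck (q := q) y) = stab y cshift_action ord0.
Proof.
rewrite -(schreier_basis_gen neck_tree) -neckE; have [g fK gK] := idx'_bij.
apply: gen_eq => [k|e]; first exact: gen_gen.
by rewrite -[e]gK; have := gen_gen (schreier_basis cshift_action t (Tr := Tr) y \o idx') (g e).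
Qed.

Lemma neck_framing (F : groupType) (y : option Z -> F) :
  framing y -> framing (neck (q := q) y).
Proof.
move=> fry; have [+ _] := framing_reindex idx'_bij (schreier_framing fry neck_tree).
by rewrite neckE.
Qed.

End NecklaceBasis.

(** * Subgroups of finite index as stabilizers *)

Section CosetAction.
Variables (F : groupType) (J : finType) (y : J -> F) (A : set F) (s : seq F).
Hypotheses (gA : is_subgroup A).
Hypothesis sP : forall x, exists2 z, z \in s & A (z^-1 * x).

Let idx x := find (fun z => `[< A (z^-1 * x) >]) s.

Let idx_lt x : idx x < size s.
Proof.
rewrite -has_find; apply/hasP; have [z zs Az] := sP x.
by exists z => //; apply/asboolP.
Qed.

Let idxP x x' : idx x = idx x' <-> A (x^-1 * x').
Proof.
have nthP u : A ((nth 1 s (idx u))^-1 * u).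
  by apply/asboolP; apply: (@nth_find _ 1 (fun z => `[< A (z^-1 * u) >])); rewrite has_find; apply: idx_lt.
split=> [e|Axx'].
  have := subgroupM gA (subgroupV gA (nthP x)) (nthP x').
  by rewrite -e invgM invgK mulgA mulgK.
apply: eq_find => z; apply/asboolP/asboolP => Az.
  by have := subgroupM gA Az Axx'; rewrite mulgA mulgK.
by have := subgroupM gA Az (subgroupV gA Axx'); rewrite invgM invgK mulgA mulgK.
Qed.

(** The action is on the left cosets of [A] that meet [gen y], through inverses
    so that words act on the right. *)
Lemma coset_action : exists (T : finType) (p : J -> {perm T}) (o : T),
  [/\ #|T| <= size s, forall v, exists w, ev p w o = v &
      forall w, ev p w o = o <-> A (ev y w)].
Proof.
pose orb (i : 'I_(size s)) := `[< exists w, val i = idx (ev y w)^-1 >].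
pose T : finType := {i | orb i}.
have orbw w : orb (Ordinal (idx_lt (ev y w)^-1)) by apply/asboolP; exists w.
pose cls w : T := exist _ (Ordinal (idx_lt (ev y w)^-1)) (orbw w).
have clsP u v : cls u = cls v <-> A (ev y u * (ev y v)^-1).
  rewrite -{1}[ev y u]invgK -idxP; split=> [/(congr1 (fun i => val (val i)))//|e].
  by apply/val_inj/val_inj.
have [r rP] : {r : T -> word J & forall i, cls (r i) = i}.
  apply: (@choice _ _ (fun i w => cls w = i)) => i.
  have /asboolP[w wi] := valP i.
  by exists w; apply/val_inj/val_inj.
pose act j i := cls (rcons (r i) (false, j)).
have actE j w : act j (cls w) = cls (rcons w (false, j)).
  apply/clsP; rewrite !ev_rcons /= invgM mulgA mulgK.
  by apply/clsP; rewrite rP.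
have act_inj j : injective (act j).
  move=> i k; rewrite -(rP i) -(rP k) !actE => /clsP.
  by rewrite !ev_rcons /= invgM mulgA mulgK => /clsP.
pose p j : {perm T} := perm (@act_inj j).
have pE w v : ev p w (cls v) = cls (v ++ w).
  elim: w v => [|[b j] w IH] v; first by rewrite perm1 cats0.
  rewrite ev_cons permM -cat1s catA -IH; congr (ev p w _).
  case: b => /=; last by rewrite permE actE cats1.
  apply: (perm_inj (s := p j)); rewrite permKV permE actE.
  apply/clsP; rewrite ev_rcons ev_cat ev1 /= mulgKV mulgV.
  exact: subgroup1 gA.
exists T, p, (cls [::]); split.
- by rewrite card_sig -[leqRHS]card_ord; apply: max_card.
- by move=> i; exists (r i); rewrite pE rP.
- by move=> w; rewrite pE clsP invg1 mulg1.
Qed.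

End CosetAction.

Lemma stab_eq (G : groupType) (J : Type) (T : finType) (y : J -> G)
    (p : J -> {perm T}) (o : T) (A : set G) :
  (forall w, ev p w o = o <-> A (ev y w)) -> stab y p o = A `&` gen y.
Proof.
move=> pA; apply/seteqP; split=> [_ [w /= wo <-]|x [Aw [w _ e]]].
  by split; [apply/pA|apply: genP].
by exists w => //; apply/pA; rewrite e.
Qed.

(** The Nielsen-Schreier theorem with the index formula. *)
Lemma stab_framing (F : groupType) (J T : finType) (y : J -> F)
    (p : J -> {perm T}) (o : T) : framing y ->
  (forall v, exists w, ev p w o = v) ->
  exists (I : finType) (a : I -> F),
    [/\ framing a, gen a = stab y p o & #|I| + #|T| = (#|T| * #|J|).+1].
Proof.
move=> fry tr; have [t [Tr [tP cT]]] := schreier_tree_exists tr.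
exists _, (schreier_basis p t (Tr := [in Tr]) y); split.
- exact: schreier_framing tP.
- exact: schreier_basis_gen tP _ _.
- exact: card_nontree.
Qed.

(** * Nielsen reduction *)

Section Lcp.
Variable L : eqType.
Implicit Types s t : seq L.

Fixpoint lcp s t : nat :=
  if s is x :: s' then
    if t is y :: t' then if x == y then (lcp s' t').+1 else 0 else 0
  else 0.

Lemma lcpC s t : lcp s t = lcp t s.
Proof. by elim: s t => [|x s IH] [|y t] //=; rewrite eq_sym; case: eqP; rewrite // IH. Qed.

Lemma lcp_sizel s t : lcp s t <= size s.
Proof. by elim: s t => [|x s IH] [|y t] //=; case: eqP => // _; apply: IH. Qed.

Lemma lcp_sizer s t : lcp s t <= size t.
Proof. by rewrite lcpC lcp_sizel. Qed.

Lemma lcp_take s t : take (lcp s t) s = take (lcp s t) t.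
Proof. by elim: s t => [|x s IH] [|y t] //=; case: eqP => //= ->; rewrite IH. Qed.

Lemma lcp_refl s : lcp s s = size s.
Proof. by elim: s => //= x s ->; rewrite eqxx. Qed.

Lemma lcp_cat s t t' : size s <= lcp (s ++ t) (s ++ t').
Proof. by elim: s => //= x s IH; rewrite eqxx. Qed.

(** The strict case of the ultrametric inequality in the tree of words. *)
Lemma lcp_trans s t u : lcp t u < lcp s t -> lcp s u = lcp t u.
Proof.
elim: s t u => [|x s IH] [|y t] [|z u] //=; case: (eqVneq x y) => // ->.
by case: eqP => // _; rewrite ltnS => /IH ->.
Qed.

Lemma lcp_next s t d : lcp s t < size s -> lcp s t < size t ->
  nth d s (lcp s t) != nth d t (lcp s t).
Proof. by elim: s t => [|x s IH] [|y t] //=; case: eqVneq => // _; apply: IH. Qed.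

End Lcp.

Section WordProduct.
Variable J : eqType.
Implicit Types u v w : word J.

(** The reduced form of the product of the inverse of [u] with [v]. *)
Definition dmul u v : word J :=
  winv (drop (lcp u v) u) ++ drop (lcp u v) v.

Lemma ev_dmul (G : groupType) (a : J -> G) u v :
  ev a (dmul u v) = (ev a u)^-1 * ev a v.
Proof.
rewrite /dmul; set k := lcp u v.
have cut w : ev a w = ev a (take k w) * ev a (drop k w).
  by rewrite -ev_cat cat_take_drop.
rewrite ev_cat ev_winv (cut u) (cut v) -lcp_take -/k invgM -mulgA.
by rewrite mulKg.
Qed.

Lemma size_dmul u v : size (dmul u v) = (size u + size v - (lcp u v).*2)%N.
Proof.
rewrite /dmul size_cat size_winv !size_drop.
move: (lcp_sizel u v) (lcp_sizer u v); move: (lcp u v) (size u) (size v) => k m n.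
lia.
Qed.

Lemma reduced_winv w : reduced w -> reduced (winv w).
Proof.
case: w => [//|x w]; rewrite /reduced /= /winv -map_rev.
rewrite -[sorted _ _]/(sorted (@nocancel J) (map (@linv J) (rev (x :: w)))) sorted_map.
rewrite rev_sorted /= => h; apply: sub_path h => y z.
by rewrite /relpre /= /nocancel => nyz; apply: contraNneq nyz => /(can_inj (@linvK J)) ->; rewrite linvK.
Qed.

Lemma reduced_drop k w : reduced w -> reduced (drop k w).
Proof. exact: drop_sorted. Qed.

Lemma reduced_dmul u v : reduced u -> reduced v -> reduced (dmul u v).
Proof.
move=> ru rv; rewrite /dmul; set k := lcp u v.
have [ku|ku] := leqP (size u) k; first by rewrite (drop_oversize ku); apply: reduced_drop.
have [kv|kv] := leqP (size v) k.
  by rewrite (drop_oversize kv) cats0; apply/reduced_winv/reduced_drop.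
have [d _] : exists d : bool * J, true by case: (u) ku => // x; exists x.
have := lcp_next d ku kv; rewrite -/k.
have := reduced_winv (reduced_drop k ru); have := reduced_drop k rv.
rewrite (drop_nth d ku) (drop_nth d kv); move: (nth d u k) (nth d v k) => x y.
move: (drop _ u) (drop _ v) => u' v' rv' ru' nxy.
rewrite /reduced /= in rv'.
move: ru'; rewrite -cat1s winv_cat -catA /reduced.
case: (winv u') => [_|z w] /=.
  by rewrite rv' andbT /nocancel linvK eq_sym.
rewrite !cat_path => /andP[-> /= /andP[-> _]] /=.
by rewrite rv' andbT /nocancel linvK eq_sym.
Qed.

(** A non-empty reduced word shares less than half of itself with its inverse:
    otherwise its middle letters would cancel. *)
Lemma lcp_winv w : reduced w -> w != [::] -> (lcp w (winv w)).*2 < size w.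
Proof.
move=> rw w0; rewrite ltnNge; apply/negP => hw.
have [d _] : exists d : bool * J, true by case: (w) w0 => // x; exists x.
pose k := lcp w (winv w); have sw : 0 < size w by case: (w) w0.
have kw : k <= size w by apply: lcp_sizel.
have E i : i < k -> nth d w i = linv (nth d w (size w - i.+1)).
  move=> ik; rewrite -(nth_take d ik w) /k lcp_take -/k nth_take //.
  have iw : i < size w by apply: leq_trans ik kw.
  rewrite /winv nth_rev size_map // (nth_map d) //.
  by rewrite subnS -subn1; lia.
pose i := (uphalf (size w)).-1.
have ik : i < k by rewrite /i /k; lia.
have := E _ ik; have [oddw|evw] := boolP (odd (size w)).
  have -> : (size w - i.+1 = i)%N by rewrite /i; lia.
  by case: (nth d w i) => -[] j.
have ei : (size w - i.+1 = i.+1)%N by rewrite /i; lia.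
have iw : i.+1 < size w by rewrite /i; lia.
rewrite ei => e; have /(sortedP d)/(_ _ iw) := rw.
by rewrite /nocancel e linvK eqxx.
Qed.

End WordProduct.

Section Code.
Variable L : finType.
Implicit Types s t : seq L.

(** Words of equal length are compared through their value in base [#|L|], an
    order that is preserved by appending a common suffix. *)
Definition code s : nat := foldl (fun c x => c * #|L| + enum_rank x)%N 0 s.

Lemma code_rcons s x : code (rcons s x) = (code s * #|L| + enum_rank x)%N.
Proof. by rewrite /code -cats1 foldl_cat. Qed.

Lemma code_cat_lt s t u : code s < code t -> code (s ++ u) < code (t ++ u).
Proof.
move=> st; elim/last_ind: u => [|u x IH]; first by rewrite !cats0.
rewrite -!rcons_cat !code_rcons ltn_add2r ltn_mul2r IH andbT.
by apply/card_gt0P; exists x.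
Qed.

Lemma code_inj s t : size s = size t -> code s = code t -> s = t.
Proof.
elim/last_ind: s t => [|s x IH] t; first by move=> /esym/size0nil.
case/lastP: t => [|t y]; rewrite ?size_rcons // => -[st].
rewrite !code_rcons => e; have L0 : 0 < #|L| by apply/card_gt0P; exists x.
have xy : enum_rank x = enum_rank y.
  apply/val_inj; have /(congr1 (modn^~ #|L|)) := e.
  by rewrite !modnMDl !modn_small.
move: e; rewrite xy => /addIn/eqP; rewrite eqn_pmul2r // => /eqP /(IH _ st) ->.
by rewrite (enum_rank_inj xy).
Qed.

(** This breaks ties in Nielsen reduction: a move that preserves the length of
    the basis may still replace the first half of a word by a smaller one. *)
Definition half_code s : nat := code (take (uphalf (size s)) s).

Lemma half_code_lt p q u : size p = size q -> (size p).*2 <= size (p ++ u) ->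
  code p < code q -> half_code (p ++ u) < half_code (q ++ u).
Proof.
move=> pq pu cpq; have qu : size (q ++ u) = size (p ++ u) by rewrite !size_cat pq.
have pk : size p <= uphalf (size (p ++ u)) by lia.
rewrite /half_code qu; move: (uphalf _) pk => h pk.
rewrite !take_cat -pq [h < _]ltnNge pk /=; exact: code_cat_lt.
Qed.

Lemma half_code_eq p q u : size p = size q -> (size p).*2 <= size (p ++ u) ->
  half_code (u ++ p) = half_code (u ++ q).
Proof.
move=> pq pu; have uq : size (u ++ q) = size (u ++ p) by rewrite !size_cat pq.
have ku : uphalf (size (u ++ p)) <= size u by move: pu; rewrite !size_cat; lia.
rewrite /half_code uq !takel_cat //.
Qed.

End Code.

(** Sizes and common prefixes are generalized first, since the same term may
    occur through several instances of the structure on letters. *)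
Ltac slia :=
  repeat match goal with
  | H : is_true (leq _ _) |- _ => move: H
  | H : @eq nat _ _ |- _ => move: H
  end;
  repeat match goal with
  | |- context [@size ?T ?s] => let n := fresh "n" in move: (@size T s) => n
  | |- context [@lcp ?T ?s ?t] => let n := fresh "n" in move: (@lcp T s t) => n
  end; intros; lia.

Definition upd (I : eqType) (T : Type) (y : I -> T) (k : I) (g : T) (i : I) : T :=
  if i == k then g else y i.

Lemma lex_min (T : Type) (P : T -> Prop) (f g : T -> nat) : (exists x, P x) ->
  exists2 x, P x & forall z, P z -> f x <= f z /\ (f z = f x -> g x <= g z).
Proof.
have mn (h : T -> nat) (Q : T -> Prop) : (exists x, Q x) ->
    exists2 x, Q x & forall z, Q z -> h x <= h z.
  move=> [x0 Q0]; pose R n := `[< exists2 x, Q x & h x = n >].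
  have exR : exists n, R n by exists (h x0); apply/asboolP; exists x0.
  case: (ex_minnP exR) => n /asboolP[x Qx <-] nR; exists x => // z Qz.
  by apply: nR; apply/asboolP; exists z.
move=> exP; have [x1 P1 m1] := mn f P exP.
have [|x [Px fx] mx] := mn g (fun x => P x /\ f x = f x1); first by exists x1.
exists x => // z Pz; rewrite fx; split=> [|fz]; first exact: m1.
by apply: mx.
Qed.

Section Nielsen.
Variables (G : groupType) (J I : finType) (a : J -> G).
Hypothesis fa : free a.
Variable P : (I -> G) -> Prop.
Hypothesis P_free : forall y, P y -> free y.
Hypothesis P_gen : forall y, P y -> gen y = gen a.
Hypothesis P_move : forall y i k b e, P y -> i != k ->
  P (upd y k (sgn b (y i) * sgn e (y k))).

Let nf g : word J := reduce (word_of a g).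

Let nf_red g : reduced (nf g). Proof. exact: reduce_reduced. Qed.

Let nfK g : gen a g -> ev a (nf g) = g.
Proof. by move=> ag; rewrite ev_reduce word_ofK. Qed.

Let nf_ev w : reduced w -> nf (ev a w) = w.
Proof.
move=> rw; have : dmul (nf (ev a w)) w = [::].
  apply: (free_reduced fa); first exact: reduced_dmul.
  by rewrite ev_dmul nfK ?mulVg //; apply: genP.
rewrite /dmul; set k := lcp _ _ => e; have /eqP := congr1 size e.
rewrite size_cat size_winv addn_eq0 => /andP[/eqP/size0nil e1 /eqP/size0nil e2].
rewrite -[LHS](cat_take_drop k) -[RHS](cat_take_drop k) e1 e2 !cats0.
exact: lcp_take.
Qed.

Let nfV g : gen a g -> nf g^-1 = winv (nf g).
Proof.
by move=> ag; rewrite -{1}(nfK ag) -ev_winv nf_ev //; apply: reduced_winv.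
Qed.

Let nf_dmul g h : gen a g -> gen a h -> nf (g^-1 * h) = dmul (nf g) (nf h).
Proof.
move=> ag ah; rewrite -{1}(nfK ag) -{1}(nfK ah) -ev_dmul nf_ev //.
exact: reduced_dmul.
Qed.

Let len (y : I -> G) := \sum_i size (nf (y i)).
Let hcode (w : word J) := (half_code w + half_code (winv w))%N.
Let weight (y : I -> G) := \sum_i hcode (nf (y i)).

Section Minimal.
Variable y : I -> G.
Hypothesis Py : P y.
Hypothesis y_min : forall z, P z ->
  len y <= len z /\ (len z = len y -> weight y <= weight z).

Let W (x : bool * I) : word J := nf (sgn x.1 (y x.2)).

Let ay x : gen a (sgn x.1 (y x.2)).
Proof.
rewrite -(P_gen Py); case: x => -[] i /=; last exact: gen_gen.
exact: subgroupV (gen_subgroup y) (gen_gen y i).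
Qed.

Let Wlinv x : W (linv x) = winv (W x).
Proof. by rewrite /W /= sgnV nfV. Qed.

Let W_neq0 x : W x != [::].
Proof.
apply/eqP => W0; have := nfK (ay x); rewrite -/(W x) W0 -ev1.
by move=> /esym/(free_reduced (P_free Py)) => /(_ isT).
Qed.

Let sizeW x : size (W x) = size (nf (y x.2)).
Proof.
rewrite /W; case: x => -[] i //=; rewrite nfV ?size_winv //.
exact: (ay (false, i)).
Qed.

Let hcodeW x : hcode (W x) = hcode (nf (y x.2)).
Proof.
rewrite /W; case: x => -[] i //=; rewrite nfV; last exact: (ay (false, i)).
by rewrite /hcode winvK addnC.
Qed.

Let move_nf x z :
  nf (sgn (~~ x.1) (y x.2) * sgn z.1 (y z.2)) = dmul (W x) (W z).
Proof. by rewrite sgnV nf_dmul. Qed.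

Let sum_upd (f : word J -> nat) k g :
  (\sum_i f (nf (upd y k g i)) + f (nf (y k)) = \sum_i f (nf (y i)) + f (nf g))%N.
Proof.
rewrite (bigD1 k) //= [in RHS](bigD1 k) //= /upd eqxx.
rewrite (eq_bigr (fun i => f (nf (y i)))) => [|i /negPf -> //].
by rewrite addnC addnA [RHS]addnAC.
Qed.

(** Otherwise multiplying the second word by the inverse of the first one would
    shorten it. *)
Let N1 x z : x.2 != z.2 -> (lcp (W x) (W z)).*2 <= size (W x).
Proof.
move=> xz; have [le _] := y_min (P_move (~~ x.1) z.1 Py xz).
have := sum_upd size z.2 (sgn (~~ x.1) (y x.2) * sgn z.1 (y z.2)).
rewrite move_nf size_dmul -(sizeW z) -/(len _) -/(len y).
have := lcp_sizel (W x) (W z); have := lcp_sizer (W x) (W z).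
move: le; move: (lcp _ _) (size (W x)) (size (W z)) (len y) (len (upd _ _ _)).
by move=> l m n c d; lia.
Qed.

Let N1' x z : x != z -> (lcp (W x) (W z)).*2 <= size (W x).
Proof.
move=> xz; have [e|] := eqVneq x.2 z.2; last exact: N1.
have -> : z = linv x.
  case: x z xz e => [b i] [c j] /= + e; rewrite -{j}e.
  by case: b c => -[] //; rewrite ?eqxx.
by rewrite Wlinv ltnW // lcp_winv // nf_red.
Qed.

Let N1r x z : x != z -> (lcp (W x) (W z)).*2 <= size (W z).
Proof. by rewrite eq_sym lcpC; apply: N1'. Qed.

(** If [W x] cancels the first half of [W v] exactly, multiplying [W x] by the
    inverse of [W v] preserves its length and exchanges this half for the first
    half of the inverse of [W v]. *)
Let code_min x v : x.2 != v.2 -> size (W v) = (lcp (W x) (W v)).*2 ->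
  code (take (lcp (W x) (W v)) (W v)) <=
  code (take (lcp (W x) (W v)) (winv (W v))).
Proof.
move=> xv; set k := lcp (W x) (W v) => sv; rewrite leqNgt; apply/negP.
set p := take k (W v); set q := take k (winv (W v)) => cqp.
have vx : v.2 != x.2 by rewrite eq_sym.
have sp : size p = k by rewrite size_takel // sv -addnn leq_addr.
have sq : size q = k by rewrite size_takel // size_winv sv -addnn leq_addr.
have Ux : W x = p ++ drop k (W x) by rewrite /p -lcp_take cat_take_drop.
have kx : k.*2 <= size (W x) by apply: N1'; apply: contraNneq xv => ->.
have new : dmul (W v) (W x) = q ++ drop k (W x).
  rewrite /dmul lcpC -/k; congr (_ ++ _); rewrite /q /winv -map_rev take_rev.
  by rewrite size_map sv -map_drop -addnn addnK map_rev.
have := y_min (P_move (~~ v.1) x.1 Py vx).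
set y' := upd _ _ _ => -[_ le].
have e1 := sum_upd size x.2 (sgn (~~ v.1) (y v.2) * sgn x.1 (y x.2)).
have e2 := sum_upd hcode x.2 (sgn (~~ v.1) (y v.2) * sgn x.1 (y x.2)).
move: e1 e2; rewrite -/y' -/(len y') -/(len y) -/(weight y') -/(weight y) !move_nf new.
rewrite -(sizeW x) -(hcodeW x).
have -> : size (q ++ drop k (W x)) = size (W x) by rewrite {2}Ux !size_cat sp sq.
move=> /addIn /le {le}.
have : hcode (q ++ drop k (W x)) < hcode (W x).
  rewrite /hcode {3 4}Ux !winv_cat -addSn; apply: leq_add.
    apply: half_code_lt => //; first by rewrite sp sq.
    by rewrite size_cat sq size_drop; slia.
  rewrite (@half_code_eq _ (winv q) (winv p)) ?size_winv ?sp ?sq //.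
  by rewrite size_cat !size_winv sq size_drop; slia.
slia.
Qed.

(** A generator is never absorbed by its two neighbours. By [N1'] each of them
    would cancel exactly one half of it; [code_min] on both sides would make
    these halves inverse to each other, and the generator trivial. *)
Let N2 x v z : x != v -> z != linv v ->
  lcp (W x) (W v) + lcp (W (linv v)) (W z) < size (W v).
Proof.
move=> xv zv; rewrite ltnNge; apply/negP => le.
have h1 := N1r xv; have h2 := N1r zv.
move: h2 le; rewrite [lcp (W (linv v)) _]lcpC => h2 le.
have sv' : size (W (linv v)) = size (W v) by rewrite Wlinv size_winv.
have e1 : size (W v) = (lcp (W x) (W v)).*2 by slia.
have e2 : size (W (linv v)) = (lcp (W z) (W (linv v))).*2 by slia.
have e12 : lcp (W x) (W v) = lcp (W z) (W (linv v)) by slia.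
set k := lcp (W x) (W v) in e1 e12.
pose p := take k (W v); pose q := take k (winv (W v)).
have sp : size p = k by rewrite size_takel // e1 -addnn leq_addr.
have sq : size q = k by rewrite size_takel // size_winv e1 -addnn leq_addr.
have Wv : W v = p ++ winv q.
  rewrite -[LHS](cat_take_drop k); congr (_ ++ _).
  apply: (can_inj (@winvK J)); rewrite winvK /q /winv -map_rev take_rev.
  by rewrite size_map e1 -map_drop -addnn addnK map_rev.
have npq : p != q.
  apply/eqP => epq; have := W_neq0 v; have rv : reduced (W v) by apply: nf_red.
  rewrite -(nf_ev rv) Wv.
  by rewrite epq ev_cat ev_winv mulgV -(ev_nil a) nf_ev.
have px : take k (W x) = p by apply: lcp_take.
have qz : take k (W z) = q by rewrite e12 lcp_take -e12 Wlinv.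
have xv2 : x.2 != v.2.
  apply: contraNneq npq => exv; have xE : x = linv v.
    case: (x) (v) xv exv => [b i] [c j] /= + e; rewrite -{j}e.
    by case: b c => -[] //; rewrite ?eqxx.
  by rewrite -px xE Wlinv.
have zv2 : z.2 != (linv v).2.
  apply: contraNneq npq => ezv; have zE : z = v.
    case: (z) (v) zv ezv => [b i] [c j] /= + e; rewrite -{j}e.
    by case: b c => -[] //; rewrite ?eqxx.
  by rewrite -qz zE.
have c1 := code_min xv2 e1; have c2 := code_min zv2 e2.
move: c1 c2; rewrite -/k -e12 !Wlinv winvK => c1 c2.
move/eqP: npq; apply; apply: code_inj; rewrite ?sp ?sq //.
by apply/eqP; rewrite eqn_leq c1.
Qed.

(** Some letter of each factor survives in a reduced product of generators: the
    end of the product, read backwards, follows the inverse of the last factor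
    further than any cancellation with a next factor. By [N1'] the length never
    decreases when a factor is added. *)
Let N3 w x : reduced (rcons w x) ->
  (forall z, z != linv x -> lcp (W (linv x)) (W z) <
     lcp (nf (ev y (rcons w x))^-1) (W (linv x))) /\
  (0 < size w -> 1 < size (nf (ev y (rcons w x)))).
Proof.
have ga u : gen a (ev y u) by rewrite -(P_gen Py); apply: genP.
have gaV u : gen a (ev y u)^-1 by rewrite -ev_winv.
have W1 u : 0 < size (W u) by case: (W u) (W_neq0 u).
have Wl u : nf (ev y [:: u])^-1 = W (linv u) by rewrite ev1 -sgnV.
elim/last_ind: w x => [|w x IH] z.
  move=> _; split=> // u uz; rewrite Wl lcp_refl.
  have : linv z != u by rewrite eq_sym.
  by move=> /N1'; have := W1 (linv z); slia.
move=> rwz; have rw : reduced (rcons w x).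
  by move: rwz; rewrite /reduced -cats1 => /cat_sorted2[].
have zx : z != linv x.
  case: (w) rwz => [|s w'] /=; first by rewrite andbT.
  by rewrite rcons_path last_rcons => /andP[_].
have [/(_ _ zx) IH1 IH2] := IH _ rw.
have ag := ga (rcons w x); have agV := gaV (rcons w x); have az := ay z.
set g := ev y (rcons w x) in IH1 IH2 ag agV.
have sE : lcp (nf g^-1) (W z) = lcp (W (linv x)) (W z) by apply: lcp_trans.
have gz : ev y (rcons (rcons w x) z) = g * sgn z.1 (y z.2) by rewrite ev_rcons.
have nfgz : nf (g * sgn z.1 (y z.2)) = dmul (nf g^-1) (W z).
  by rewrite -{1}[g]invgK nf_dmul //.
have nfgzV : nf (g * sgn z.1 (y z.2))^-1 = dmul (W z) (nf g^-1).
  by rewrite invgM nf_dmul //.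
have szg : size (nf g^-1) = size (nf g) by rewrite nfV // size_winv.
have xz : linv x != z by rewrite eq_sym.
have s1 := N1' xz; have s2 := N1r xz.
rewrite gz nfgzV nfgz size_dmul sE szg; split=> [u uz|_].
  have h := N2 xz uz; rewrite -(ltn_add2l (lcp (W (linv x)) (W z))); apply: leq_trans h _.
  rewrite (Wlinv z) /dmul [lcp (W z) _]lcpC sE; set s := lcp (W (linv x)) (W z).
  have -> : winv (W z) = winv (drop s (W z)) ++ winv (take s (W z)).
    by rewrite -winv_cat cat_take_drop.
  apply: leq_trans (leq_add (leqnn s) (lcp_cat _ _ _)).
  by rewrite size_winv size_drop; have := lcp_sizer (W (linv x)) (W z); slia.
case: (posnP (size w)) => [/size0nil w0|/IH2]; last by slia.
have -> : size (nf g) = size (W (linv x)).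
  by rewrite -szg /g w0 -Wl.
have := W1 (linv x); have := W1 z; slia.
Qed.

Lemma nielsen_minimal j : exists x, a j = sgn x.1 (y x.2).
Proof.
have : gen y (a j) by rewrite (P_gen Py); apply: gen_gen.
move=> [w0 _]; rewrite -ev_reduce; have := reduce_reduced w0.
case/lastP: (reduce w0) => [_ /esym aj|w x /N3[_ N3x] awx].
  have aj1 : ev a [:: (false, j)] = 1 by rewrite ev1.
  by have := free_reduced fa (w := [:: (false, j)]) isT aj1.
exists x; have saj : size (nf (a j)) = 1%N.
  have -> : a j = ev a [:: (false, j)] by rewrite ev1.
  by rewrite nf_ev.
move: N3x; rewrite awx saj; case: w awx => [awx _|z w _ /(_ isT)//].
by rewrite -awx -ev1.
Qed.

End Minimal.

(** The theorem of Nielsen, for a property [P] that is stable under elementary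
    moves. A basis of minimal length, and of minimal weight among those, is
    Nielsen reduced; reduced products of two or more of its elements have length
    at least two, so every letter of [a] is an element of the basis up to sign. *)
Theorem nielsen : (exists y, P y) ->
  exists2 y, P y & forall j, exists x, a j = sgn x.1 (y x.2).
Proof.
move=> /(lex_min len weight)[y Py y_min]; exists y => // j.
exact: nielsen_minimal.
Qed.

End Nielsen.

(** * Elementary moves on framings and the invariance of the rank *)

Definition subst1 (J : eqType) (k : J) (w : word J) (l : J) : word J :=
  if l == k then w else [:: (false, l)].

Lemma upd_subst1 (G : groupType) (J : eqType) (y : J -> G) k w :
  upd y k (ev y w) = fun l => ev y (subst1 k w l).
Proof. by apply/funext => l; rewrite /upd /subst1; case: eqP; rewrite ?ev1. Qed.

Lemma framing_move (F : groupType) (J : eqType) (y : J -> F) i k b e :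
  framing y -> i != k ->
  framing (upd y k (sgn b (y i) * sgn e (y k))) /\
  gen (upd y k (sgn b (y i) * sgn e (y k))) = gen y.
Proof.
move=> fry ik.
have -> : sgn b (y i) * sgn e (y k) = ev y [:: (b, i); (e, k)].
  by rewrite !ev_cons mulg1.
rewrite upd_subst1; apply: (framing_subst (s' := subst1 k
  (if e then [:: (true, k); (b, i)] else [:: (~~ b, i); (false, k)]))) => //.
- move=> H h j; rewrite -upd_subst1 /subst1; case: eqVneq => [->|jk].
    by case: e; rewrite !ev_cons /upd eqxx (negPf ik) /= !mulg1 ?sgnV ?invgM ?invgK
      ?mulKg ?mulgKV.
  by rewrite ev1 /= /upd (negPf jk).
- move=> H h j; rewrite -upd_subst1 /subst1; case: eqVneq => [->|jk].
    by case: e; rewrite !ev_cons /upd eqxx (negPf ik) /= !mulg1 ?sgnV ?invgM ?invgK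
      ?mulKVg ?mulgK //; case: b; rewrite /= ?invgK ?mulKVg ?mulVKg.
  by rewrite ev1 /= /upd (negPf jk).
Qed.

Lemma framing_sgn_inj (F : groupType) (J : eqType) (a : J -> F) b e j l : free a ->
  sgn b (a j) = sgn e (a l) -> b = e /\ j = l.
Proof.
move=> fa eq1; have [//|ne] := eqVneq (b, j) (e, l); first by case.
have := free_reduced fa (w := [:: (~~ b, j); (e, l)]).
rewrite !ev_cons mulg1 /= sgnV eq1 mulVg; move=> /(_ _ erefl) H.
suff /H : reduced [:: (~~ b, j); (e, l)] by [].
by rewrite /reduced /= andbT /nocancel /linv /= negbK eq_sym.
Qed.

(** Nielsen reduction of one basis to the other maps the index set of the second
    injectively to that of the first. *)
Lemma framing_rank (F : groupType) (I J : finType) (y : I -> F) (a : J -> F) :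
  framing y -> framing a -> gen y = gen a -> #|I| = #|J|.
Proof.
suff le (I' J' : finType) (z : I' -> F) (b : J' -> F) :
    framing z -> framing b -> gen z = gen b -> #|J'| <= #|I'|.
  by move=> fy fa e; apply/eqP; rewrite eqn_leq (le _ _ _ _ fa fy (esym e)) (le _ _ _ _ fy fa e).
move=> frz frb zb; have [fb _] := frb.
have [||||x [fx xb] xP] := nielsen (P := fun x : I' -> F => framing x /\ gen x = gen b) fb.
- by move=> x [[]].
- by move=> x [].
- by move=> x i k e e' [fx xb] ik; have [f1 f2] := framing_move e e' fx ik; rewrite f2.
- by exists z.
have [r rP] : {r : J' -> bool * I' & forall j, b j = sgn (r j).1 (x (r j).2)}.
  exact: (@choice _ _ (fun j (l : bool * I') => b j = sgn l.1 (x l.2))).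
have inj : injective (fun j => (r j).2).
  move=> j k jk; have := rP j; rewrite jk => bj.
  have : sgn (r j).1 (b j) = sgn (r k).1 (b k).
    by rewrite bj rP; case: (r j).1; case: (r k).1; rewrite /= ?invgK.
  by case/(framing_sgn_inj fb).
exact: leq_card inj.
Qed.

Section NormalMoves.
Variables (F : groupType) (N : normal_subgroup (Comm F)).

Let gN : is_subgroup (nsub N) := @nsub_subgroup _ N.

(** Framings related in this way determine, together with any third framing,
    the same element of the quotient by [N]. *)
Definition nmoves (J : Type) (y z : J -> F) : Prop :=
  exists2 c, nsub N c & moves c y z.

Lemma nmoves_sym (J : Type) (y z : J -> F) : nmoves y z -> nmoves z y.
Proof.
by move=> [c Nc /moves_inv m]; exists c^-1 => //; apply: subgroupV gN Nc.
Qed.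

Lemma nmoves_trans (J : Type) (y z x : J -> F) :
  nmoves y z -> nmoves z x -> nmoves y x.
Proof.
move=> [c Nc m] [d Nd m']; exists (c * d); last exact: moves_mul m m'.
exact: subgroupM gN Nc Nd.
Qed.

Lemma nmoves_subst (I J : Type) (y z : J -> F) (s : I -> word J) :
  nmoves y z -> nmoves (fun i => ev y (s i)) (fun i => ev z (s i)).
Proof. by move=> [c Nc m]; exists c => //; apply: moves_subst. Qed.

Lemma nmoves_comp (I J : Type) (y z : J -> F) (f : I -> J) :
  nmoves y z -> nmoves (y \o f) (z \o f).
Proof.
move=> [c Nc m]; exists c => //.
by apply: moves_ext (moves_subst (fun i => [:: (false, f i)]) m) => i; rewrite ev1.
Qed.

Lemma nmoves_reindex (I J : Type) (y z : J -> F) (f : I -> J) : bijective f ->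
  nmoves (y \o f) (z \o f) -> nmoves y z.
Proof.
move=> [g fK gK] /(nmoves_comp g)[c Nc m]; exists c => //.
by apply: moves_ext m => j /=; rewrite gK.
Qed.

(** The commensurator acts transitively on the framings with a given index type,
    and [N] is normal; so a change of basis belongs to [N] for all of them or
    for none. *)
Lemma nmoves_transport (J : Type) (y y' : J -> F) (s : J -> word J) :
  framing y -> framing y' ->
  nmoves y (fun j => ev y (s j)) -> nmoves y' (fun j => ev y' (s j)).
Proof.
move=> fry fry' [c Nc m]; have [d md] := moves_ex fry fry'.
exists (c ^ d); first exact: nsub_normal.
rewrite conjgE; apply: moves_mul (moves_inv md) _.
exact: moves_mul m (moves_subst s md).
Qed.

(** ** Displacement *)

Section Displacement.
Variables (Z : finType) (y : option Z -> F).
Hypotheses (fry : framing y) (Ny : nsub N (inn (y None))).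
Let g := neck (q := 2) y.
Let frg : framing g := neck_framing 1 fry.
Let i0 : 'I_2 := ord0.
Let i1 : 'I_2 := ord_max.

Let eqii i z z' : (Some (i, z) == Some (i, z') :> option ('I_2 * Z)) = (z == z').
Proof. by rewrite (inj_eq Some_inj) xpair_eqE eqxx. Qed.

Let neq01 z z' : (Some (i0, z) == Some (i1, z') :> option ('I_2 * Z)) = false.
Proof. by []. Qed.

Let neq10 z z' : (Some (i1, z) == Some (i0, z') :> option ('I_2 * Z)) = false.
Proof. by []. Qed.

(** The conjugation by [y None], as a substitution on the basis of the double
    cover; [w'] is its inverse. *)
Let w (k : option ('I_2 * Z)) : word (option ('I_2 * Z)) :=
  match k with
  | None => [:: (false, None)]
  | Some (i, z) => if i == i0 then [:: (false, Some (i1, z))]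
                   else [:: (false, None); (false, Some (i0, z)); (true, None)]
  end.

Let w' (k : option ('I_2 * Z)) : word (option ('I_2 * Z)) :=
  match k with
  | None => [:: (false, None)]
  | Some (i, z) => if i == i1 then [:: (false, Some (i0, z))]
                   else [:: (true, None); (false, Some (i1, z)); (false, None)]
  end.

Let i01 (i : 'I_2) : i = i0 \/ i = i1.
Proof. by case: i => -[|[|//]] i2; [left|right]; apply/val_inj. Qed.

Let ww' (H : groupType) (h : option ('I_2 * Z) -> H) k :
  ev (fun k => ev h (w k)) (w' k) = h k.
Proof.
case: k => [[i z]|] /=; last by rewrite !mulg1.
case: (i01 i) => -> /=; rewrite ?mulg1 // !mulgA.
by rewrite mulVg mul1g mulgKV.
Qed.

Let gf : (fun k => g k ^ (y None)^-1) = fun k => ev g (w k).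
Proof.
apply/funext => -[[i z]|]; rewrite conjgE invgK /g.
  case: (i01 i) => -> /=; rewrite !mulg1 !neck_Some ?neck_None /=.
    by rewrite expg0 expg1 invg1 mul1g mulg1 mulgA.
  by rewrite expg0 expg1 invg1 mul1g mulg1 (expgS _ 1) expg1 invgM !mulgA.
by rewrite /= mulg1 neck_None mulgA -expgS expgSr mulgK.
Qed.

Variables (z1 z2 z3 : Z).
Hypotheses (z12 : z1 != z2) (z13 : z1 != z3) (z23 : z2 != z3).
Let A := Some (i0, z1).
Let B := Some (i0, z2).
Let C := Some (i0, z3).
Let A' := Some (i1, z1).
Let B' := Some (i1, z2).
Let sA := subst1 A [:: (false, A); (false, B)].
Let sA' := subst1 A' [:: (false, A'); (false, B')].
Let sB := subst1 B [:: (false, B); (false, C)].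

Let fr_right k l : k != l ->
  framing (fun j => ev g (subst1 k [:: (false, k); (false, l)] j)).
Proof.
move=> kl; suff [] : framing (fun j => ev g (subst1 k [:: (false, k); (false, l)] j)) /\
  gen (fun j => ev g (subst1 k [:: (false, k); (false, l)] j)) = gen g by [].
apply: (framing_subst (s' := subst1 k [:: (false, k); (true, l)])) => // H h j;
  rewrite -upd_subst1 /subst1; case: eqVneq => [->|jk];
  rewrite ?ev1 /= /upd ?(negPf jk) // eqxx eq_sym (negPf kl) !mulg1.
- by rewrite mulgK.
- by rewrite mulgKV.
Qed.

(** Conjugation by [y None], an element of [N], moves a substitution supported
    on the generators [(0, z)] to one supported on the generators [(1, z)],
    and those commute with the first kind; hence the substitutions of the first
    kind commute modulo [N]. A transvection is a commutator of two of them. *)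
Lemma displaced_transvection :
  exists2 d, framing d & nmoves d (upd d A (d A * d C)).
Proof.
have frA : framing (fun j => ev g (sA j)) by apply: fr_right; apply: contraNneq z12 => -[->].
have frB : framing (fun j => ev g (sB j)) by apply: fr_right; apply: contraNneq z23 => -[->].
have [c mc] := moves_ex frg frA; have [t mt] := moves_ex frg frB.
set f := inn (y None)^-1.
have Nf : nsub N f by rewrite /f innV; apply: subgroupV gN Ny.
have mf : moves f g (fun k => ev g (w k)) by rewrite -gf; apply: moves_inn.
have mc' : moves (c ^ f) g (fun j => ev g (sA' j)).
  have m1 : moves (c ^ f) (fun k => ev g (w k))
      (fun k => (ev g (sA k)) ^ (y None)^-1).
    rewrite conjgE; apply: moves_mul (moves_inv mf) _.
    exact: moves_mul mc (moves_inn _ _).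
  apply: moves_ext (moves_subst w' m1) => k; first exact: ww'.
  rewrite -[RHS](ww' (fun j => ev g (sA' j))); apply: eq_ev => {}k.
  rewrite -[ev g (sA k)]/((fun j => ev g (sA j)) k) -!upd_subst1.
  have gE l : g l ^ (y None)^-1 = ev g (w l) by have := congr1 (@^~ l) gf.
  case: k => [[i z]|]; last by rewrite /= !mulg1 /upd gE /= mulg1.
  case: (i01 i) => -> /=; rewrite !mulg1 /upd /A /A' /B /B' ?eqii ?neq10 ?neq01.
    by case: (z == z1) => /=; [rewrite conjMg !gE|rewrite gE]; rewrite /= !mulg1.
  by rewrite gE /= mulg1.
have comm_ct' : (c ^ f) * t = t * (c ^ f).
  apply: (moves_uniq (proj2 frg) (moves_mul mc' (moves_subst sA' mt))).
  apply: moves_ext (moves_mul mt (moves_subst sB mc')) => // k.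
  have n1 : (A' == B) = false := neq10 _ _; have n2 : (B' == B) = false := neq10 _ _.
  have n3 : (B == A') = false := neq01 _ _; have n4 : (C == A') = false := neq01 _ _.
  rewrite /sB /sA' /subst1; case: (eqVneq k A') => [->|kA'].
    by rewrite n1 /= ?eqxx ?n1 ?n2 /= ?mulg1.
  case: (eqVneq k B) => [->|kB]; rewrite /= ?eqxx ?n3 ?n4 ?(negPf kA') ?(negPf kB) //=.
  by rewrite ?mulg1.
have qc : quo N c = quo N (c ^ f).
  apply/quoP; rewrite conjgE mulgA.
  have -> : c^-1 * (f^-1) * (c * f) = (f^-1) ^ c * f by rewrite conjgE !mulgA.
  apply: (subgroupM gN) => //; apply: nsub_normal; exact: subgroupV gN Nf.
have : quo N (t * c) = quo N (c * t).
  by rewrite -!quoM qc !quoM comm_ct'.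
move=> /quoP Nct.
(* In the basis obtained from [g] by [sA] and then [sB], the commutator of the
   two substitutions is a transvection. *)
exists (fun j => ev (fun l => ev g (sA l)) (sB j)).
  apply: moves_framing frg; exact: moves_mul mt (moves_subst sB mc).
exists ((t * c)^-1 * (c * t)) => //.
have m2 := moves_mul mc (moves_subst sA mt).
apply: moves_ext (moves_mul (moves_inv (moves_mul mt (moves_subst sB mc))) m2) => // k.
have n1 : (B == A) = false by rewrite eqii eq_sym (negPf z12).
have n2 : (C == A) = false by rewrite eqii eq_sym (negPf z13).
have n3 : (C == B) = false by rewrite eqii eq_sym (negPf z23).
have n4 : (A == B) = false by rewrite eqii (negPf z12).
rewrite /upd /sA /sB /subst1; case: (eqVneq k A) => [_|kA].
  by rewrite /= ?eqxx ?n1 ?n2 ?n4 /= ?eqxx ?n3 ?n4 /= ?eqxx ?n2 /= ?mulg1 ?mulgA.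
rewrite /= ?n1; case: (eqVneq k B) => [_|kB]; rewrite /= ?eqxx ?n1 ?n2 ?(negPf kA) ?(negPf kB) //=.
by rewrite ?mulg1.
Qed.

End Displacement.
End NormalMoves.

(** * Elementary moves realized in a normal subgroup *)

Section ElementaryMoves.
Variables (F : groupType) (N : normal_subgroup (Comm F)).

Definition transvections_in (r : nat) : Prop :=
  forall (J : finType) (y : J -> F), #|J| = r -> framing y ->
  forall i k, i != k -> nmoves N y (upd y k (y k * y i)).

Definition elementary_in (r : nat) : Prop :=
  forall (J : finType) (y : J -> F), #|J| = r -> framing y ->
  forall i k b e, i != k -> nmoves N y (upd y k (sgn b (y i) * sgn e (y k))).

Lemma nmoves_framing (J : Type) (y z : J -> F) :
  nmoves N y z -> framing y -> framing z.
Proof. by move=> [c _]; apply: moves_framing. Qed.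

Lemma upd_comp (I J : eqType) (y : J -> F) (f : I -> J) i g :
  injective f -> upd y (f i) g \o f = upd (y \o f) i g.
Proof. by move=> fi; apply/funext => j; rewrite /upd /= (inj_eq fi). Qed.

Lemma displacement_transvections (Z : finType) (y : option Z -> F) :
  2 < #|Z| -> framing y -> nsub N (inn (y None)) ->
  transvections_in (#|Z|.*2.+1).
Proof.
move=> Z3 fry Ny J x cJ frx i k ik.
pose z n (n3 : (n < 3)%N) := enum_val (Ordinal (leq_trans n3 Z3)).
have zP n m n3 m3 : n != m -> @z n n3 != @z m m3.
  by apply: contraNneq => /enum_val_inj/(congr1 val)/= ->.
have [d frd dm] := displaced_transvection fry Ny (zP 0%N 1%N isT isT isT)
  (zP 0%N 2%N isT isT isT) (zP 1%N 2%N isT isT isT).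
move: dm; set A := Some (_, z 0%N _); set C := Some _ => dm.
have AC : A != C by rewrite /A /C (inj_eq Some_inj) xpair_eqE eqxx zP.
have ki : k != i by rewrite eq_sym.
have [|f [bf fA fC]] := card_bij2 (I := option ('I_2 * Z)) (J := J) _ AC ki.
  by rewrite card_option card_prod card_ord cJ mul2n.
apply: (nmoves_reindex bf); rewrite -fA -fC upd_comp; last exact: bij_inj.
have [frf _] := framing_reindex bf frx.
have E (u : option ('I_2 * Z) -> F) : upd u A (u A * u C) =
    fun j => ev u (subst1 A [:: (false, A); (false, C)] j).
  by rewrite -upd_subst1 !ev_cons mulg1.
rewrite -[x (f A)]/((x \o f) A) -[x (f C)]/((x \o f) C) E.
by apply: (nmoves_transport frd frf); rewrite -E.
Qed.

Section FromTransvections.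
Variable r : nat.
Hypothesis rt : transvections_in r.
Variable J : finType.
Hypothesis cJ : #|J| = r.
Implicit Types (y : J -> F).

Lemma right_move y i k : framing y -> i != k ->
  nmoves N y (upd y k (y k * y i)).
Proof. by move=> fry; apply: (rt cJ fry). Qed.

Lemma right_moveV y i k : framing y -> i != k ->
  nmoves N y (upd y k (y k * (y i)^-1)).
Proof.
move=> fry ik; have m := right_move fry ik; have frz := nmoves_framing m fry.
have E u : upd u k (u k * (u i)^-1) =
    fun j => ev u (subst1 k [:: (false, k); (true, i)] j).
  by rewrite -upd_subst1 !ev_cons mulg1.
rewrite E; apply: (nmoves_transport frz fry); rewrite -E.
set z := upd _ _ _ in m frz *; set z' := upd _ _ _.
suff -> : z' = y by apply: nmoves_sym.
apply/funext => j; rewrite /z' /z /upd eqxx (negPf ik).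
by case: eqP => [->|//]; rewrite mulgK.
Qed.

(** Inverting the two generators involved turns right multiplications into
    left ones. *)
Lemma left_move y i k : framing y -> i != k ->
  nmoves N y (upd y k (y i * y k)).
Proof.
move=> fry ik; pose s l : word J := [:: ((l == i) || (l == k), l)].
have ss (H : groupType) (h : J -> H) l : ev (fun l => ev h (s l)) (s l) = h l.
  by rewrite /s /= !mulg1; case: (_ || _); rewrite /= ?invgK.
have [frs _] := framing_subst fry ss ss.
have := nmoves_subst s (right_move frs ik).
have -> : (fun i => ev (fun i => ev y (s i)) (s i)) = y by apply/funext => l; apply: ss.
congr nmoves; apply/funext => l; rewrite ev1 /upd; case: (eqVneq l k) => [->|lk].
  by rewrite /s /= !eqxx !orbT /= !mulg1 -invgM invgK.
by rewrite /s /= (negPf lk) !orbF mulg1; case: (l == i); rewrite /= ?invgK.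
Qed.

Lemma left_moveV y i k : framing y -> i != k ->
  nmoves N y (upd y k ((y i)^-1 * y k)).
Proof.
move=> fry ik; have m := left_move fry ik; have frz := nmoves_framing m fry.
have E u : upd u k ((u i)^-1 * u k) =
    fun j => ev u (subst1 k [:: (true, i); (false, k)] j).
  by rewrite -upd_subst1 !ev_cons mulg1.
rewrite E; apply: (nmoves_transport frz fry); rewrite -E.
set z := upd _ _ _ in m frz *; set z' := upd _ _ _.
suff -> : z' = y by apply: nmoves_sym.
apply/funext => j; rewrite /z' /z /upd eqxx (negPf ik).
by case: eqP => [->|//]; rewrite mulKg.
Qed.

(** The pair [(y i, y k)] becomes [(y k, (y i)^-1)], a quarter turn: its square
    inverts both generators. *)
Lemma rotate_move y i k : framing y -> i != k ->
  nmoves N y (upd (upd y i (y k)) k (y i)^-1).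
Proof.
move=> fry ik; have ki : k != i by rewrite eq_sym.
have m1 := right_move fry ki; have fr1 := nmoves_framing m1 fry.
have m2 := right_moveV fr1 ik; have fr2 := nmoves_framing m2 fr1.
have m3 := left_move fr2 ki.
have := nmoves_trans (nmoves_trans m1 m2) m3; congr nmoves.
apply/funext => j; rewrite /upd !eqxx (negPf ik) (negPf ki).
case: (eqVneq j i) => [->|ji]; rewrite ?(negPf ik).
  by rewrite invgM !mulgA mulgV mul1g mulVg mul1g.
by rewrite invgM !mulgA mulgV mul1g.
Qed.

Lemma invert_two y i k : framing y -> i != k ->
  nmoves N y (upd (upd y i (y i)^-1) k (y k)^-1).
Proof.
move=> fry ik; have ki : k != i by rewrite eq_sym.
have m1 := rotate_move fry ik; have fr1 := nmoves_framing m1 fry.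
have := nmoves_trans m1 (rotate_move fr1 ik); congr nmoves.
apply/funext => j; rewrite /upd !eqxx (negPf ik).
by case: (j == k) => //; case: (j == i).
Qed.

End FromTransvections.

(** In the double cover that unwinds another generator, the inversion of one
    generator becomes the inversion of two. *)
Lemma invert_option (Z : finType) (y : option Z -> F) z :
  transvections_in (#|Z|.*2.+1) -> framing y ->
  nmoves N y (upd y (Some z) (y (Some z))^-1).
Proof.
move=> rt fry; set y' := upd _ _ _.
have E u : upd u (Some z) (u (Some z))^-1 =
    fun j => ev u (subst1 (Some z) [:: (true, Some z)] j).
  by rewrite -upd_subst1 ev1.
have fry' : framing y'.
  rewrite /y' E; set sz := subst1 _ _.
  have ss (H : groupType) (h : option Z -> H) l : ev (fun j => ev h (sz j)) (sz l) = h l.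
    rewrite /sz /subst1; case: (eqVneq l (Some z)) => [->|lz].
      by rewrite /= eqxx /= !mulg1 invgK.
    by rewrite /= (negPf lz) /= !mulg1.
  by case: (framing_subst fry ss ss).
have [c mc] := moves_ex fry fry'.
pose g := neck (q := 2) y; have frg : framing g := neck_framing 1 fry.
have mc2 : moves c g (neck (q := 2) y') by apply: moves_subst.
pose i0 : 'I_2 := ord0; pose i1 : 'I_2 := ord_max.
pose A : option ('I_2 * Z) := Some (i0, z); pose B : option ('I_2 * Z) := Some (i1, z).
have AB : A != B by [].
have cI : #|{: option ('I_2 * Z)}| = #|Z|.*2.+1.
  by rewrite card_option card_prod card_ord mul2n.
have [d Nd md] := invert_two rt cI frg AB.
suff cd : c = d by exists c; rewrite ?cd // -cd.
suff {mc2 Nd} E2 : neck (q := 2) y' = upd (upd g A (g A)^-1) B (g B)^-1.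
  by apply: (moves_uniq (proj2 frg) mc2); rewrite E2.
have i01 (i : 'I_2) : i = i0 \/ i = i1.
  by case: i => -[|[|//]] i2; [left|right]; apply/val_inj.
have gE i : g (Some (i, z)) = y None ^+ i * y (Some z) * (y None ^+ i)^-1 := neck_Some y i z.
apply/funext => -[[i x]|]; last by rewrite neck_None /upd /= /g neck_None.
rewrite neck_Some {1 3}/y' {1 2}/upd /=.
have [->|xz] := eqVneq x z.
  rewrite {1}/y' /upd eqxx.
  by case: (i01 i) => -> /=; rewrite ?eqxx /= gE !invgM invgK mulgA.
rewrite /y' /upd !(inj_eq Some_inj) !xpair_eqE (negPf xz) !andbF.
by rewrite /g neck_Some.
Qed.

Lemma elementary_of_transvections r : 0 < r ->
  transvections_in r.+1 -> transvections_in r.*2.+1 -> elementary_in r.+1.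
Proof.
move=> r0 rt rt2 J y cJ fry i k b e ik.
have inv (x : J -> F) : framing x -> nmoves N x (upd x k (x k)^-1).
  move=> frx; have ki : k != i by rewrite eq_sym.
  pose z : 'I_r := Ordinal r0.
  have [|f [bf fz fi]] := card_bij2 (I := option 'I_r) (J := J) (i1 := Some z)
    (i2 := None) _ isT ki; first by rewrite card_option card_ord.
  apply: (nmoves_reindex bf); rewrite -fz upd_comp; last exact: bij_inj.
  by apply: invert_option; rewrite ?card_ord //; case: (framing_reindex bf frx).
have [y1 m1 yE] : exists2 y1, nmoves N y y1 & y1 = upd y k (sgn e (y k)).
  case: e => /=; first by exists (upd y k (y k)^-1) => //; apply: inv.
  exists y; last by apply/funext => j; rewrite /upd; case: eqP => [->|].
  by exists 1; [apply: subgroup1 (@nsub_subgroup _ N)|apply: moves1].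
apply: (nmoves_trans m1).
have fr1 := nmoves_framing m1 fry.
have -> : upd y k (sgn b (y i) * sgn e (y k)) = upd y1 k (sgn b (y1 i) * y1 k).
  by apply/funext => j; rewrite yE /upd eqxx (negPf ik); case: eqP.
by case: b => /=; [apply: (left_moveV rt cJ fr1 ik)|apply: (left_move rt cJ fr1 ik)].
Qed.

End ElementaryMoves.

(** * From a non-trivial normal subgroup to a good subgroup of finite index *)

Section SubgroupType.
Variables (G : groupType) (A : set G) (gA : is_subgroup A).

Definition subgroup_type of is_subgroup A : Type := {x : G | x \in A}.
Local Notation S := (subgroup_type gA).

HB.instance Definition _ := SubType.copy S {x : G | x \in A}.
HB.instance Definition _ := [Choice of S by <:].
HB.instance Definition _ := SubChoice_isSubGroup.Build G [in A] S gA.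

Definition subgroup_groupType : groupType := S.

End SubgroupType.

(** Generation comes from uniqueness: the homomorphism to the subgroup [gen b]
    that fixes the basis, followed by the inclusion, must be the identity. *)
Lemma free_basis_framing (F : groupType) (J : Type) (b : J -> F) :
  free_basis b -> framing b /\ gen b = [set: F].
Proof.
move=> bF; have genT : gen b = [set: F].
  pose H := subgroup_groupType (gen_subgroup b).
  have bA j : b j \in gen b by rewrite inE; apply: gen_gen.
  have [f fb _] := bF H (fun j => Sub (b j) (bA j)).
  have [g _ gU] := bF F b.
  pose vf : {multiplicative F -> F} := (\val : H -> F) \o f.
  have vfE : vf =1 g by apply: gU => j; rewrite /= fb SubK.
  have idE : (idfun : F -> F) =1 g.
    exact: (gU idfun).
  apply/seteqP; split=> // x _; have := valP (f x); rewrite inE.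
  by rewrite -[X in gen b X -> _]/(vf x) vfE -idE.
split=> //; split; last by rewrite genT; apply: fi_subgroupT.
move=> w bw H h; have [f fb _] := bF H h.
have := ev_mor f b w; rewrite bw => E.
rewrite -(eq_ev (a := f \o b)) => [|j]; last exact: fb.
by rewrite -E; have := ev_mor f b [::].
Qed.

Section Hall.
Variables (F : groupType) (N : normal_subgroup (Comm F)).
Let gN : is_subgroup (nsub N) := @nsub_subgroup _ N.

(** If [phi] moves [a], its commutator with the conjugation by [a] is again a
    conjugation, by a non-trivial element. *)
Lemma inn_nontrivial : nsub N <> [set 1] -> exists2 g, g != 1 & nsub N (inn g).
Proof.
move=> N1; have [c [Nc c1]] : exists c, nsub N c /\ c <> 1.
  apply: contrapT => nE; apply: N1; apply/seteqP; split=> [c Nc|_ ->].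
    by apply: contrapT => c1; apply: nE; exists c.
  exact: subgroup1 gN.
pose phi := comm_repr c; have cE : comm_class phi = c by apply: comm_reprK.
have [a pa na] : exists2 a, vdom phi a & phi a <> a.
  apply: contrapT => nE; apply: c1; rewrite -cE; apply/comm_classP.
  apply: virt_equiv_ext => // x px; apply: contrapT => nx; apply: nE.
  by exists x.
exists (phi a * a^-1).
  by apply/eqP => /(congr1 (mulg^~ a)); rewrite mulgKV mul1g.
rewrite innM innV -inn_conj // cE conjgE.
have -> : c^-1 * (inn a * c) * (inn a)^-1 = c^-1 * c ^ (inn a)^-1.
  by rewrite conjgE invgK !mulgA.
apply: (subgroupM gN); last exact: nsub_normal.
exact: subgroupV gN Nc.
Qed.

Variables (n : nat) (b : 'I_n -> F).
Hypotheses (frb : framing b) (genb : gen b = [set: F]) (n2 : 1 < n).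

(** A shortest word will do, since conjugating a word that is not cyclically
    reduced by its first letter shortens it. *)
Lemma cyclically_reduced_word : nsub N <> [set 1] ->
  exists w : word 'I_n, [/\ 0 < size w, nsub N (inn (ev b w)) &
    forall x0 (i : 'I_(size w)), nth x0 w (ordS i) != linv (nth x0 w i)].
Proof.
move=> /inn_nontrivial[g g1 Ng].
pose P k := `[< exists w, [/\ size w = k, 0 < size w, reduced w & nsub N (inn (ev b w))] >].
have exP : exists k, P k.
  have [u _ uE] : gen b g by rewrite genb.
  exists (size (reduce u)); apply/asboolP; exists (reduce u); split=> //.
  - rewrite lt0n; apply: contra_neqN g1 => /nilP; rewrite -uE -ev_reduce => ->.
    by [].
  - exact: reduce_reduced.
  - by rewrite ev_reduce uE.
case: (ex_minnP exP) => _ /asboolP[w [<- w0 rw Nw]] w_min.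
exists w; split=> // x0 i.
have [iw|wi] := ltnP i.+1 (size w).
  by rewrite /= modn_small //; have /(sortedP x0)/(_ _ iw) := rw.
have iE : i.+1 = size w by apply/eqP; rewrite eqn_leq wi ltn_ord.
rewrite /= iE modnn; apply/eqP => e.
case: w w0 rw Nw w_min i wi iE e => // x w _ rw Nw w_min i _ /= [iE].
rewrite iE; case/lastP: w rw Nw w_min i iE => [|w z] rw Nw w_min i iE.
  by rewrite /=; case: (x) => -[] k.
rewrite size_rcons /= nth_rcons ltnn eqxx => xz.
have w0 : 0 < size w.
  by case: (w) rw => [|//]; rewrite /reduced /= andbT /nocancel xz linvK eqxx.
have : size (x :: rcons w z) <= size w.
  apply: w_min; apply/asboolP; exists w; split=> //.
    by move: rw; rewrite /reduced /= -cats1 => /path_sorted/cat_sorted2[].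
  have -> : ev b w = ev b (x :: rcons w z) ^ sgn x.1 (b x.2).
    rewrite conjgE ev_cons ev_rcons xz /= sgnV invgK !mulgA.
    by rewrite mulgV mul1g mulgK.
  have -> : inn (ev b (x :: rcons w z) ^ sgn x.1 (b x.2)) =
      inn (ev b (x :: rcons w z)) ^ inn (sgn x.1 (b x.2)).
    by rewrite !conjgE !innM innV.
  exact: nsub_normal.
by rewrite /= size_rcons; lia.
Qed.

(** A cyclically reduced word labels a closed path in a circle, which completes
    to a finite covering of the rose; the subgroup of this covering has a basis
    containing the word. *)
Lemma hall : nsub N <> [set 1] -> exists (J : finType) (y : J -> F) (j : J),
  [/\ framing y, 1 < #|J| & nsub N (inn (y j))].
Proof.
move=> /cyclically_reduced_word[w []].
case sw: (size w) => [//|l] _ Nw cw.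
have x0 : bool * 'I_n := (false, Ordinal (ltnW n2)).
have [p pP] : exists p : 'I_n -> {perm 'I_l.+1}, forall i : 'I_l.+1,
    sgn (nth x0 w i).1 (p (nth x0 w i).2) i = ordS i.
  apply: (@extend_action _ _ _ id (@ordS l.+1)) => // [i k|i _ <-].
    exact: ordS_inj.
  exact: cw.
pose t (v : 'I_l.+1) := take v w.
pose edge (i : 'I_l.+1) : 'I_l.+1 * 'I_n :=
  if (nth x0 w i).1 then (ordS i, (nth x0 w i).2) else (i, (nth x0 w i).2).
(* The tree is the circle without its last edge. *)
pose Tr e := e \in [seq edge i | i <- enum 'I_l.+1 & (i : 'I_l.+1) < l].
have ordSE (i : 'I_l.+1) : i < l -> ordS i = i.+1 :> nat.
  by move=> il; rewrite /= modn_small.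
have tP k : k <= l -> ev p (take k w) ord0 = inord k.
  elim: k => [|k IH] kl; first by rewrite take0 perm1; apply/val_inj; rewrite /= inordK.
  rewrite (take_nth x0) ?sw 1?ltnW // ev_rcons permM IH 1?ltnW //.
  have := pP (inord k); rewrite inordK 1?ltnW // => ->.
  have kl1 : k < l.+1 by apply: ltnW.
  by apply/val_inj; rewrite /= !inordK ?modn_small.
have tree : schreier_tree p ord0 t Tr.
  split; rewrite /t.
  - by move=> v; rewrite tP ?inord_val // -ltnS.
  - exact: take0.
  - move=> v e; have : v <= l by rewrite -ltnS.
    elim: (v : nat) => [|k IH] kl; first by rewrite take0.
    have kl1 : k < l.+1 by apply: ltnW.
    rewrite (take_nth x0) ?sw // -cats1 edges_cat mem_cat => /orP[/(IH (ltnW kl))//|].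
    rewrite tP 1?ltnW //.
    have kE : (inord k : 'I_l.+1) = k :> nat by rewrite inordK.
    have := pP (inord k); rewrite /Tr kE; have eE : edge (inord k) =
      if (nth x0 w k).1 then (ordS (inord k), (nth x0 w k).2) else (inord k, (nth x0 w k).2).
      by rewrite /edge kE.
    move: eE; case: (nth x0 w k) => c j /= eE pE.
    rewrite mem_seq1 => /eqP ->; apply/mapP; exists (inord k).
      by rewrite mem_filter kE kl mem_enum.
    by rewrite eE -pE; case: (c).
  - move=> v j /mapP[i]; rewrite mem_filter => /andP[il _].
    have := pP i; rewrite /edge; have tS : take (ordS i) w = rcons (take i w) (nth x0 w i).
      by rewrite ordSE // (take_nth x0) // sw ltnW.
    move: tS; case: (nth x0 w i) => -[] k tS; rewrite [sgn _ _]/= => pE [-> ->].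
      by right; rewrite -{2}pE permKV.
    by left; rewrite pE.
have last_nTr : ~~ Tr (edge ord_max).
  apply/mapP => -[i]; rewrite mem_filter => /andP[il _].
  have il' : i != ord_max by apply: contraTneq il => ->; rewrite /= ltnn.
  have c1 := cw x0.
  have := c1 i; have := c1 ord_max; rewrite /edge.
  case e1: (nth x0 w ord_max) => [[] k]; case e2: (nth x0 w i) => [[] m] h1 h2 E;
    have ef := congr1 fst E; have es : k = m := congr1 snd E.
  - by have ei : ord_max = i := ordS_inj ef; rewrite ei eqxx in il'.
  - have ei : ordS ord_max = i := ef.
    by move: h1; rewrite ei e2 es /linv /= eqxx.
  - have ei : ord_max = ordS i := ef.
    by move: h2; rewrite -ei e1 es /linv /= eqxx.
  - by have ei : ord_max = i := ef; rewrite ei eqxx in il'.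
pose y := schreier_basis p t (Tr := Tr) b.
exists _, y, (exist _ (edge ord_max) last_nTr); split.
- exact: schreier_framing frb tree.
- rewrite card_sig (eq_card (B := [predC [pred e | Tr e]])) //.
  have := cardC [pred e | Tr e]; rewrite card_prod !card_ord.
  have cT : #|[pred e | Tr e]| <= l.
    apply: leq_trans (_ : #|[pred e in [seq edge i | i <- enum 'I_l.+1 & (i : 'I_l.+1) < l]]| <= _).
      by apply: subset_leq_card; apply/fintype.subsetP.
    apply: leq_trans (card_size _) _; rewrite size_map enum_ordSr filter_rcons ltnn.
    by apply: leq_trans (size_subseq (filter_subseq _ _)) _; rewrite size_map size_enum_ord.
  have : (l.+1 * 2 <= l.+1 * n)%N by rewrite leq_mul2l n2.
  move: cT; move: #|_| #|[predC _]| => u u'; lia.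
- (* The loop through the last edge is the whole circle, in one direction or
     the other. *)
  rewrite /y /schreier_basis /=.
  have wE : w = rcons (take l w) (nth x0 w l).
    by rewrite -(take_nth x0) ?sw // -sw take_size.
  have := pP ord_max; rewrite /edge /schreier_word.
  have oS : ordS (@ord_max l) = ord0 by apply/val_inj; rewrite /= modnn.
  rewrite oS; move: wE; rewrite -[X in nth x0 w X]/(nat_of_ord (@ord_max l)).
  case: (nth x0 w ord_max) => -[] k wE /= pE.
    have -> : p k ord0 = ord_max by rewrite -pE permKV.
    rewrite /t take0 /=.
    have -> : b k * ev b (winv (take l w)) = (ev b w)^-1.
      by rewrite {2}wE ev_rcons invgM ev_winv /= invgK.
    by rewrite innV; apply: subgroupV gN Nw.
  by rewrite pE /t take0 cats1 -wE.
Qed.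

(** If the subgroup given by [hall] has rank [h.+2], its cyclic covers of degree
    [q] have rank [q * h.+1 + 1] and a basis element whose conjugation is in
    [N]; displacement in their double covers shows that the transvections are in
    [N] for the ranks [2 * q * h.+1 + 1] with [q] at least 3, and inversions
    follow. The double cover for [q = 3] and all its subgroups of finite index
    have such ranks. *)
Lemma good_framing : nsub N <> [set 1] ->
  exists (Z : finType) (y : option Z -> F),
    [/\ 0 < #|Z|, framing y & forall m, 0 < m -> elementary_in N (m * #|Z|).+1].
Proof.
move=> /hall[J [y [j0 [fry J2 Ny]]]].
have [h hE] : exists h, #|J| = h.+2 by exists #|J|.-2; lia.
have [j1 j10] : exists j1, j1 != j0.
  apply/existsP; rewrite -negb_forall; apply/negP => /forallP all0.
  have : #|J| <= #|pred1 j0| by apply/subset_leq_card/fintype.subsetP => j _; apply: all0.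
  by rewrite card1 hE.
pose z0 : 'I_h.+1 := ord0.
have [|f [bf fN fz]] := card_bij2 (I := option 'I_h.+1) (J := J) (i1 := None)
  (i2 := Some z0) _ isT j10; first by rewrite card_option card_ord hE.
have [fr1 _] := framing_reindex bf fry.
have K q : exists2 y' : option 'I_(q.+1 * h.+1) -> F, framing y' & nsub N (inn (y' None)).
  have fr2 := neck_framing q fr1.
  pose A : option ('I_q.+1 * 'I_h.+1) := Some (ord0, z0).
  pose u : 'I_(q.+1 * h.+1) := Ordinal (ltn0Sn _).
  have [|k [bk kN _]] := card_bij2 (I := option 'I_(q.+1 * h.+1))
    (J := option ('I_q.+1 * 'I_h.+1)) (i1 := None) (i2 := Some u) (j1 := A) (j2 := None)
    _ isT isT; first by rewrite !card_option card_prod !card_ord.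
  have [fr3 _] := framing_reindex bk fr2; eexists; first exact: fr3.
  by rewrite /= kN /A neck_Some expg0 invg1 mulg1 mul1g /= fz.
have T q : 2 <= q -> transvections_in N (q.+1 * h.+1).*2.+1.
  move=> q2; have [y' fr' Ny'] := K q.
  have := displacement_transvections _ fr' Ny'; rewrite card_ord; apply.
  by rewrite mulSn mulnS; lia.
have [y' fr' _] := K 2.
exists ('I_2 * 'I_(3 * h.+1))%type, (neck (q := 2) y'); split.
- by rewrite card_prod !card_ord.
- exact: neck_framing.
move=> [//|m] _; rewrite card_prod !card_ord.
have e k : (k.+1 * (2 * (3 * h.+1)) = ((3 * k.+1).-1.+1 * h.+1).*2)%N by lia.
apply: elementary_of_transvections; first by rewrite muln_gt0.
  by rewrite e; apply: T; lia.
have -> : (m.+1 * (2 * (3 * h.+1))).*2 = ((m.*2.+1).+1 * (2 * (3 * h.+1)))%N by lia.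
by rewrite e; apply: T; lia.
Qed.

End Hall.

(** * Automorphisms of subgroups of finite index lie in the normal subgroup *)

Section SignedPermutation.
Variables (F : groupType) (N : normal_subgroup (Comm F)) (J : finType).
Hypotheses (em : elementary_in N #|J|) (J2 : 1 < #|J|).
Implicit Types y : J -> F.

Lemma nmoves_refl y : nmoves N y y.
Proof. by exists 1; [apply: subgroup1 (@nsub_subgroup _ N)|apply: moves1]. Qed.

Lemma invert_move y i k : framing y -> i != k ->
  nmoves N y (upd y k (y k)^-1).
Proof.
move=> fry ik; have m1 := em erefl fry false true ik.
have := nmoves_trans m1 (em erefl (nmoves_framing m1 fry) true false ik).
congr nmoves; apply/funext => j; rewrite /upd /= eqxx (negPf ik).
by case: eqP => // _; rewrite mulKg.
Qed.

Lemma swap_move y i k : framing y -> i != k ->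
  nmoves N y (upd (upd y i (y k)^-1) k (y i)^-1).
Proof.
move=> fry ik; have ki : k != i by rewrite eq_sym.
have m1 := em erefl fry false false ik; have fr1 := nmoves_framing m1 fry.
have m2 := em erefl fr1 true false ki; have fr2 := nmoves_framing m2 fr1.
have := nmoves_trans (nmoves_trans m1 m2) (em erefl fr2 true true ik).
congr nmoves; apply/funext => j; rewrite /upd /= !eqxx (negPf ik) (negPf ki).
case: (eqVneq j k) => [_|jk].
  by rewrite (invgM _ (y i)) invgK mulgK.
by case: eqP => // _; rewrite invgM mulgKV.
Qed.

(** A signed transposition, corrected by an inversion if necessary, puts one
    more basis element in place and disturbs none of those in place. *)
Lemma signed_permutation_moves (a y : J -> F) : framing a -> framing y ->
  (forall j, exists x, a j = sgn x.1 (y x.2)) -> nmoves N y a.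
Proof.
move=> [fa _]; have [k] := ubnP #|[pred j | y j != a j]|.
elim: k y => // k IH y + fry yP; rewrite ltnS => yk.
have [allE|[j jne]] : (forall j, y j = a j) \/ exists j, y j != a j.
  have [ex|nex] := pselect (exists j, y j != a j); first by right.
  by left=> j; apply/eqP/negPn/negP => ne; apply: nex; exists j.
  by have -> : y = a by [apply/funext]; apply: nmoves_refl.
have [[b i] /= ajE] := yP j.
have step z : nmoves N y z -> z j = a j -> (forall l, z l != a l -> y l != a l) ->
    (forall l, exists x, a l = sgn x.1 (z x.2)) -> nmoves N y a.
  move=> m zj zl zP; apply: (nmoves_trans m); apply: (IH z _ (nmoves_framing m fry) zP).
  apply: leq_trans yk; apply: proper_card; apply/properP; split.
    by apply/fintype.subsetP => l; apply: zl.
  by exists j; rewrite // inE zj eqxx.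
have flip (z z' : J -> F) : (forall l, exists c, z l = sgn c (z' l)) ->
    (forall l, exists x, a l = sgn x.1 (z x.2)) ->
    forall l, exists x, a l = sgn x.1 (z' x.2).
  move=> zz' zP l; have [[c m] /= ->] := zP l; have [d ->] := zz' m.
  by exists (c (+) d, m); case: c; case: d; rewrite /= ?invgK.
have [ij|ij] := eqVneq i j.
  have bT : b = true by case: b ajE => //; rewrite ij => e; rewrite e eqxx in jne.
  have [l lj] : exists l, l != j.
    apply/existsP; rewrite -negb_forall; apply/negP => /forallP all0.
    have : #|J| <= #|pred1 j| by apply/subset_leq_card/fintype.subsetP => l _; apply: all0.
    by rewrite card1 leqNgt J2.
  apply: (step _ (invert_move fry lj)).
  - by rewrite /upd eqxx ajE bT ij.
  - by move=> m; rewrite /upd; case: (eqVneq m j) => [-> //|].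
  apply: flip yP => m; rewrite /upd; case: (eqVneq m j) => [->|_]; last by exists false.
  by exists true; rewrite /= invgK.
have yi : y i != a i.
  apply: contraNneq ij => yi; rewrite yi -[LHS]/(sgn false (a j)) in ajE.
  by have [_ ->] := framing_sgn_inj fa ajE.
have ji : j != i by rewrite eq_sym.
pose z1 := upd (upd y i (y j)^-1) j (y i)^-1; pose z2 := upd z1 j (a j).
have z1i : z1 i = (y j)^-1 by rewrite /z1 /upd (negPf ij) eqxx.
have z1j : z1 j = (y i)^-1 by rewrite /z1 /upd eqxx.
have m1 : nmoves N y z1 by apply: swap_move.
have fr1 := nmoves_framing m1 fry.
have m2 : nmoves N y z2.
  rewrite /z2 ajE; case: b ajE => ajE /=.
    suff -> : upd z1 j (y i)^-1 = z1 by [].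
    by apply/funext => l; rewrite /z1 /upd; case: eqP.
  apply: (nmoves_trans m1); have := invert_move fr1 ij.
  by rewrite z1j invgK.
apply: (step _ m2); rewrite /z2.
- by rewrite /upd eqxx.
- move=> l; rewrite /z1 /upd; case: (eqVneq l j) => [->|_]; first by rewrite eqxx.
  by case: (eqVneq l i) => [->|].
apply: (flip z1) => [l|].
  rewrite /upd; case: (eqVneq l j) => [->|_]; last by exists false.
  exists (~~ b); rewrite /z1 /upd eqxx ajE.
  by case: (b); rewrite /= ?invgK.
move=> l; have [[c m] /= ->] := yP l.
have [->|mj] := eqVneq m j; first by exists (~~ c, i); rewrite /= z1i; case: c; rewrite /= ?invgK.
have [->|mi] := eqVneq m i; first by exists (~~ c, j); rewrite /= z1j; case: c; rewrite /= ?invgK.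
by exists (c, m); rewrite /= /z1 /upd (negPf mj) (negPf mi).
Qed.

End SignedPermutation.

Section GoodSubgroup.
Variables (F : groupType) (N : normal_subgroup (Comm F)).
Variables (Z : finType) (y : option Z -> F).
Hypotheses (Z0 : 0 < #|Z|) (fry : framing y).
Hypothesis em : forall m, 0 < m -> elementary_in N (m * #|Z|).+1.

Lemma fi_framing A : fi_subgroup A -> A `<=` gen y ->
  exists (J : finType) (a : J -> F),
    [/\ framing a, gen a = A, elementary_in N #|J| & 1 < #|J|].
Proof.
move=> /fi_subgroupP[gA [s sP]] Ay.
have [T [p [o [_ tr oA]]]] := coset_action y gA sP.
have [I [a [fra aE cI]]] := stab_framing fry tr.
have T0 : 0 < #|T| by apply/card_gt0P; exists o.
have IE : #|I| = (#|T| * #|Z|).+1.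
  by move: cI; rewrite card_option mulnS; lia.
exists I, a; split=> //; last by rewrite IE ltnS muln_gt0 T0.
  by rewrite aE (stab_eq oA); apply/setIidPl.
by rewrite IE; apply: em.
Qed.

(** By [nielsen] the change of basis induced by [c] is a product of elementary
    moves. *)
Lemma carries_self c A : fi_subgroup A -> A `<=` gen y -> carries c A A ->
  nsub N c.
Proof.
move=> fiA Ay cA; have [J [a [fra aA emJ J2]]] := fi_framing fiA Ay.
have [b cab bA] := carries_moves cA aA.
have frb := moves_framing cab fra.
have [||||y' [_ _ m] y'P] := nielsen (P := fun y' : J -> F =>
    [/\ framing y', gen y' = gen a & nmoves N b y']) (proj1 fra).
- by move=> y' [[]].
- by move=> y' [].
- move=> y' i k e e' [fr' g' m] ik; have [f1 f2] := framing_move e e' fr' ik.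
  by split=> //; [rewrite f2|apply: (nmoves_trans m); apply: emJ].
- by exists b; split=> //; [rewrite aA|apply: nmoves_refl].
have fr' := nmoves_framing m frb.
have [d Nd md] := nmoves_trans m (signed_permutation_moves emJ J2 fra fr' y'P).
have : c * d = 1 by apply: (moves_uniq (proj2 fra) (moves_mul cab md)); apply: moves1.
move=> /(congr1 (mulg^~ d^-1)); rewrite mulgK mul1g => ->.
exact: subgroupV (@nsub_subgroup _ N) Nd.
Qed.

(** Modulo [N] only the subgroups matter, not the isomorphism between them. *)
Lemma quo_carries c d A B : fi_subgroup B -> B `<=` gen y ->
  carries c A B -> carries d A B -> quo N c = quo N d.
Proof.
move=> fiB By cAB dAB; apply/quoP; apply: (carries_self fiB By).
exact: carries_mul (carries_inv cAB) dAB.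
Qed.

End GoodSubgroup.

(** * Independent coverings of the two halves of a rose *)

Section Halves.
Variables (L R : finType).

Definition act_left (T : finType) (p : L -> {perm T}) (k : L + R) : {perm T} :=
  if k is inl l then p l else 1.

Definition act_right (T : finType) (u : R -> {perm T}) (k : L + R) : {perm T} :=
  if k is inr r then u r else 1.

Definition lword (w : word L) : word (L + R) := [seq (x.1, inl x.2) | x <- w].

Lemma ev_lword (G : groupType) (e : L + R -> G) w :
  ev e (lword w) = ev (fun l => e (inl l)) w.
Proof. by elim: w => [//|x w IH] /=; rewrite IH. Qed.

Lemma lword_rcons w x : lword (rcons w x) = rcons (lword w) (x.1, inl x.2).
Proof. exact: map_rcons. Qed.

Section Framing.
Variables (F : groupType) (e : L + R -> F) (T : finType) (p : L -> {perm T}) (o : T).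
Hypotheses (fre : framing e) (tr : forall v, exists w, ev p w o = v).

Let edges_lword v w :
  edges (act_left p) v (lword w) = [seq (x.1, inl x.2) | x <- edges p v w].
Proof.
elim: w v => [//|[b l] w IH] v /=; rewrite -IH; congr (_ :: _).
by case: b.
Qed.

(** When the second half acts trivially, a spanning tree uses only generators
    of the first half, and the Schreier basis of the stabilizer consists of
    elements of the first half together with conjugates of the generators of the
    second half by elements of the first. *)
Lemma half_framing : exists (I : finType) (s : I + T * R -> F),
  [/\ framing s, gen s = stab e (act_left p) o, #|I| + #|T| = (#|T| * #|L|).+1,
      forall i, gen (fun l => e (inl l)) (s (inl i)) &
      forall v r, exists2 x, gen (fun l => e (inl l)) x &
        s (inr (v, r)) = x * e (inr r) * x^-1].
Proof.
have [t [Tr [[tP t0 eT TE] cT]]] := schreier_tree_exists tr.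
pose t' v := lword (t v).
pose Tr' (k : T * (L + R)) := if k.2 is inl l then (k.1, l) \in Tr else false.
have tree : schreier_tree (act_left p) o t' Tr'.
  split=> [v||v k|v [l|r]]; rewrite /t' ?t0 //.
  - by rewrite ev_lword tP.
  - by rewrite edges_lword => /mapP[[v' l] /eT lT ->].
  - by rewrite /Tr' /= => /TE[] ->; rewrite lword_rcons; [left|right].
pose I : finType := {k : T * L | k \notin Tr}.
pose kap (k : I + T * R) : T * (L + R) :=
  match k with inl i => ((val i).1, inl (val i).2) | inr (v, r) => (v, inr r) end.
have kapT k : ~~ Tr' (kap k).
  by case: k => [[[v l] vl]|[v r]].
pose kap' k : {k | ~~ Tr' k} := exist _ (kap k) (kapT k).
have bk : bijective kap'.
  apply: inj_card_bij.
    move=> [[[v l] h]|[v r]] [[[v' l'] h']|[v' r']] /(congr1 val) //=.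
      by move=> [vv ll]; congr inl; apply/val_inj; rewrite /= vv ll.
    by move=> [-> ->].
  have sk : forall k : {k | ~~ Tr' k}, exists k', kap' k' = k.
    move=> [[v [l|r]] h]; first by exists (inl (exist _ (v, l) h)); apply/val_inj.
    by exists (inr (v, r)); apply/val_inj.
  have [g gK] : {g : {k | ~~ Tr' k} -> I + T * R & forall k, kap' (g k) = k}.
    exact: (@choice _ _ (fun k k' => kap' k' = k)).
  exact: leq_card (can_inj gK).
pose sb := schreier_basis (act_left p) t' (Tr := Tr') e.
have [frs gs] := framing_reindex bk (schreier_framing fre tree).
have gL := gen_subgroup (fun l => e (inl l)).
exists I, (sb \o kap'); split=> //.
- by rewrite gs; apply: schreier_basis_gen tree _ _.
- exact: card_nontree.
- move=> i; rewrite /= /sb /schreier_basis /= /schreier_word ev_cat ev_cons ev_winv !ev_lword.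
  apply: (subgroupM gL); first exact: genP.
  apply: (subgroupM gL); first exact: (gen_gen (fun l => e (inl l))).
  by apply: (subgroupV gL); apply: genP.
- move=> v r; exists (ev (fun l => e (inl l)) (t v)); first exact: genP.
  rewrite /= /sb /schreier_basis /= /schreier_word ev_cat ev_cons ev_winv !ev_lword.
  by rewrite /= perm1 mulgA.
Qed.

End Framing.

(** The class matches the conjugates of the generators of the second half in the
    two stabilizers. Only these see the action [u], which therefore cuts out the
    same words in the two bases. *)
Lemma half_covering_change (F : groupType) (e : L + R -> F) (T T' : finType)
    (p : L -> {perm T}) (o : T) (p' : L -> {perm T'}) (o' : T') :
  framing e -> #|T| = #|T'| ->
  (forall v, exists w, ev p w o = v) -> (forall v, exists w, ev p' w o' = v) ->
  exists2 c, carries c (stab e (act_left p) o) (stab e (act_left p') o') &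
    forall (U : finType) (u : R -> {perm U}) (z : U),
      carries c (stab e (act_left p) o `&` stab e (act_right u) z)
                (stab e (act_left p') o' `&` stab e (act_right u) z).
Proof.
move=> fre cT tr tr'; have [fe _] := fre.
have [I [s [frs gs cI sL sR]]] := half_framing fre tr.
have [I' [s' [frs' gs' cI' sL' sR']]] := half_framing fre tr'.
have [f bf] : exists f : I -> I', bijective f by apply: card_bij; move: cI cI'; rewrite cT; lia.
have [g bg] : exists g : T -> T', bijective g by apply: card_bij.
pose h (k : I + T * R) : I' + T' * R :=
  match k with inl i => inl (f i) | inr (v, r) => inr (g v, r) end.
have bh : bijective h.
  have [f' fK f'K] := bf; have [g' gK g'K] := bg.
  exists (fun k => match k with inl i => inl (f' i) | inr (v, r) => inr (g' v, r) end).
    by case=> [i|[v r]] /=; rewrite ?fK ?gK.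
  by case=> [i|[v r]] /=; rewrite ?f'K ?g'K.
have [frh gh] := framing_reindex bh frs'.
have [c mc] := moves_ex frs frh.
exists c; first by have := moves_gen mc; rewrite gs gh gs'.
move=> U u z; pose om (k : I + T * R) : {perm U} := if k is inr (v, r) then u r else 1.
have key (q : I + T * R -> F) : (forall k, gen e (q k)) ->
    (forall i, gen (fun l => e (inl l)) (q (inl i))) ->
    (forall v r, exists2 x, gen (fun l => e (inl l)) x & q (inr (v, r)) = x * e (inr r) * x^-1) ->
    gen q `&` stab e (act_right u) z = [set ev q w | w in [set w | ev om w z = z]].
  move=> qe qL qR; have L1 x : gen (fun l => e (inl l)) x -> gen e x /\ ext e (act_right u) x = 1.
    move=> [w _ <-]; split; first by rewrite -ev_lword; apply: genP.
    rewrite -ev_lword extE // ev_lword.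
    by elim: w => [//|[b l] w IH]; rewrite ev_cons IH /=; case: b; rewrite /= ?invg1 mulg1.
  have qE k : ext e (act_right u) (q k) = om k.
    case: k => [i|[v r]] /=; first by have [] := L1 _ (qL i).
    have [x /L1[xe x1] ->] := qR v r; have er := gen_gen e (inr r).
    have gE := gen_subgroup e.
    rewrite !extM //; last by apply: subgroupV gE xe.
      by rewrite extV // x1 ext_gen // invg1 mulg1 mul1g.
    exact: subgroupM gE xe er.
  have evq w : gen e (ev q w) /\ ext e (act_right u) (ev q w) = ev om w.
    split; first by apply: subgroup_ev => //; apply: gen_subgroup.
    by rewrite ext_ev //; apply: eq_ev.
  apply/seteqP; split=> [_ [[w _ <-] [w' /= w'z w'E]]|_ [w /= wz <-]].
    exists w => //=; have [_ <-] := evq w.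
    by rewrite -w'E extE.
  split; first exact: genP.
  have [[w' _ w'E] wE] := evq w; exists w' => //=.
  by rewrite -(extE (act_right u) fe) w'E wE.
have se k : gen e (s k).
  by have := gen_gen s k; rewrite gs; apply: stab_sub.
have se' k : gen e ((s' \o h) k).
  by have := gen_gen (s' \o h) k; rewrite gh gs'; apply: stab_sub.
rewrite -gs -gs' -gh (key s) // (key (s' \o h)) //.
- exact: (moves_words (fun w => ev om w z = z) mc).
- by move=> i /=.
- by move=> v r /=.
Qed.

End Halves.

(** * Putting a covering in normal position *)

Lemma stab_ext (G : groupType) (K K' : Type) (T : finType) (e : K -> G)
    (e' : K' -> G) (p : K -> {perm T}) (o : T) : free e -> gen e' = gen e ->
  stab e' (fun k => ext e p (e' k)) o = stab e p o.
Proof.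
move=> fe ee'; have e'e k : gen e (e' k) by rewrite -ee'; apply: gen_gen.
have E w : ev (fun k => ext e p (e' k)) w = ext e p (ev e' w) by rewrite ext_ev.
apply/seteqP; split=> [_ [w /= wo <-]|_ [w /= wo <-]].
  have : gen e (ev e' w) by rewrite -ee'; apply: genP.
  move=> [v _ vE]; exists v => //=.
  by rewrite -(extE p fe) vE -E.
have : gen e' (ev e w) by rewrite ee'; apply: genP.
by move=> [v _ vE]; exists v => //=; rewrite E vE extE.
Qed.

Lemma bij_avoid (K : finType) (a b : nat) (x0 : K) (X : {set K}) :
  (a + b)%N = #|K| -> #|X| <= a ->
  exists th : 'I_a + 'I_b -> K, bijective th /\ forall r, th (inr r) \notin X.
Proof.
move=> abK Xa; pose s := enum X ++ enum (~: X)%SET.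
have us : uniq s.
  rewrite cat_uniq !enum_uniq andbT /=; apply/hasPn => x.
  by rewrite !mem_enum inE.
have ss : size s = (a + b)%N by rewrite size_cat -!cardE cardsC abK.
pose idx (k : 'I_a + 'I_b) : nat := match k with inl i => i | inr j => a + j end.
have idx_lt k : idx k < size s.
  rewrite ss; case: k => [i|j] /=; last by rewrite ltn_add2l.
  by apply: leq_trans (ltn_ord i) _; rewrite leq_addr.
exists (fun k => nth x0 s (idx k)); split.
  apply: inj_card_bij; last by rewrite card_sum !card_ord abK.
  move=> k k' /eqP; rewrite nth_uniq // => /eqP.
  case: k => [i|j]; case: k' => [i'|j'] /=.
  - by move=> /val_inj ->.
  - by move=> e; have := ltn_ord i; rewrite e ltnNge leq_addr.
  - by move=> e; have := ltn_ord i'; rewrite -e ltnNge leq_addr.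
  - by move=> /addnI/val_inj ->.
move=> r /=; rewrite nth_cat -cardE ltnNge.
have aX : #|X| <= a + r by apply: leq_trans Xa _; rewrite leq_addr.
rewrite aX /=; have : nth x0 (enum (~: X)%SET) (a + r - #|X|) \in enum (~: X)%SET.
  apply: mem_nth; have := idx_lt (inr r); rewrite size_cat -cardE /= => h.
  by rewrite ltn_subLR.
by rewrite mem_enum inE.
Qed.

Section NormalPosition.
Variables (F : groupType) (N : normal_subgroup (Comm F)).
Variables (Z : finType) (y : option Z -> F).
Hypotheses (Z0 : 0 < #|Z|) (fry : framing y).
Hypothesis em : forall m, 0 < m -> elementary_in N (m * #|Z|).+1.

(** Each permutation that occurs is kept at one generator of the first half, and
    the other generators with the same permutation are divided by it. *)
Lemma normal_position (K T : finType) (a b : nat) (e : K -> F)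
    (p : K -> {perm T}) (o : T) (eh : 'I_a + 'I_b -> F) :
  framing e -> gen e `<=` gen y -> (forall v, exists w, ev p w o = v) ->
  framing eh -> gen eh = gen e -> (a + b)%N = #|K| -> 0 < #|K| ->
  #|{perm T}| <= a ->
  exists2 n, nsub N n & exists2 ph : 'I_a -> {perm T},
    carries n (stab e p o) (stab eh (act_left ph) o) &
    forall v, exists w, ev ph w o = v.
Proof.
move=> fre ey tr freh ehe abK /card_gt0P[x0 _] pa; have [fe fie] := fre.
have [r rP] : {r : {perm T} -> K & forall q k, p k = q -> p (r q) = q}.
  apply: (@choice _ _ (fun (q : {perm T}) (k' : K) => forall k, p k = q -> p k' = q)) => q.
  have [[k kq]|nk] := pselect (exists k, p k = q); first by exists k.
  by exists x0 => k kq; case: nk; exists k.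
have [|th [bth thX]] := @bij_avoid K a b x0 [set r q | q : {perm T}]%SET abK.
  exact: leq_trans (leq_imset_card _ _) pa.
have [th' thK th'K] := bth.
have [lf lfP] : {lf : 'I_b -> 'I_a & forall j, p (th (inl (lf j))) = p (th (inr j))}.
  apply: (@choice _ _ (fun j (l : 'I_a) => p (th (inl l)) = p (th (inr j)))) => j.
  case E: (th' (r (p (th (inr j))))) => [l|j'].
    by exists l; rewrite -E th'K (rP _ _ erefl).
  have := thX j'; rewrite -E th'K => /negP[].
  by apply/imsetP; exists (p (th (inr j))).
have [fr2 g2] := framing_reindex bth fre.
pose s3 (k : 'I_a + 'I_b) : word ('I_a + 'I_b) :=
  match k with inl l => [:: (false, inl l)]
             | inr j => [:: (false, inr j); (true, inl (lf j))] end.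
pose s3' (k : 'I_a + 'I_b) : word ('I_a + 'I_b) :=
  match k with inl l => [:: (false, inl l)]
             | inr j => [:: (false, inr j); (false, inl (lf j))] end.
have [||fr3 g3] := framing_subst (s := s3) (s' := s3') fr2.
- by move=> H h [l|j] /=; rewrite ?mulg1 // mulgKV.
- by move=> H h [l|j] /=; rewrite ?mulg1 // mulgK.
set e3 := fun k => ev _ (s3 k) in fr3 g3.
pose ph l := p (th (inl l)).
have e3E k : ext e p (e3 k) = act_left ph k.
  have gE := gen_subgroup e; have ge k' : gen e (e k') := gen_gen e k'.
  case: k => [l|j]; rewrite /e3 /= mulg1 /=; first by rewrite ext_gen.
  rewrite extM //; last by apply: subgroupV gE (ge _).
  by rewrite extV // !ext_gen // lfP mulgV.
have ge3 : gen e3 = gen e by rewrite g3 g2.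
have stE : stab e3 (act_left ph) o = stab e p o.
  rewrite -(stab_ext p o fe ge3); congr stab; apply/funext => k.
  by rewrite e3E.
have [n mn] := moves_ex fr3 freh.
have nE : carries n (gen e) (gen e) by have := moves_gen mn; rewrite ge3 ehe.
exists n; first exact: (carries_self Z0 fry em fie ey nE).
exists ph; first by rewrite -stE; apply: (moves_words (fun w => ev (act_left ph) w o = o) mn).
move=> v; have [w wv] := tr v.
have : gen e3 (ev e w) by rewrite ge3; apply: genP.
move=> [w3 _ w3E]; exists (pmap (fun x : bool * ('I_a + 'I_b) =>
  if x.2 is inl l then Some (x.1, l) else None) w3).
have lE u : ev ph (pmap (fun x : bool * ('I_a + 'I_b) =>
    if x.2 is inl l then Some (x.1, l) else None) u) = ev (act_left ph) u.
  elim: u => [//|[c [l|j]] u IH] /=; rewrite IH //.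
  by case: c; rewrite /= ?invg1 mul1g.
rewrite lE -(eq_ev e3E) -ext_ev //; last by move=> k; rewrite -ge3; apply: gen_gen.
by rewrite w3E extE.
Qed.

(** ** Cyclic coverings of large prime order *)

Section PrimeCover.
Variable q' : nat.
Let q := q'.+1.
Hypothesis q_prime : prime q.
Let chi : F -> {perm 'I_q} := ext y (@cshift_action Z q').
Let fy : free y := proj1 fry.

Let chi_cshift x : chi x \in <[cshift q']>.
Proof.
rewrite /chi /ext; elim: (word_of y x) => [|[b [z|]] w IH]; first exact: group1.
  by rewrite ev_cons groupM //=; case: b => /=; rewrite ?invg1 group1.
by rewrite ev_cons groupM //=; case: b => /=; rewrite ?groupV cycle_id.
Qed.

Let chi_gen g : g \in <[cshift q']> -> g != 1 -> <[g]> = <[cshift q']>.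
Proof.
move=> gr g1; apply/eqP; rewrite eqEcard cycle_subG gr /= -!orderE order_cshift.
have := order_dvdG gr; rewrite -orderE order_cshift => /(primeP q_prime).2.
by rewrite order_eq1 (negPf g1) /= => /eqP ->.
Qed.

Let hc (I : Type) (g : {perm 'I_q}) (k : option I) : {perm 'I_q} :=
  if k is None then g else 1.

Let hcX (I : Type) g k w : ev (@hc I (g ^+ k)) w = ev (hc g) w ^+ k.
Proof.
have cg v : commute g (ev (@hc I g) v).
  elim: v => [|[b [z|]] v IH]; first exact: commute1.
    by rewrite ev_cons; case: b => /=; rewrite ?invg1 mul1g.
  rewrite ev_cons; apply: commuteM IH; case: b => //=.
  exact: commuteV.
elim: w => [|[b [z|]] w IH]; rewrite ?expg1n // !ev_cons IH.
  by case: b => /=; rewrite ?invg1 !mul1g.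
rewrite expgMn.
  by case: b => //=; rewrite expgVn.
case: b => /=; last exact: cg.
exact/commute_sym/commuteV/commute_sym/cg.
Qed.

Let hc1 (I : Type) g w : g \in <[cshift q']> -> g != 1 ->
  ev (@hc I g) w = 1 <-> ev (hc (cshift q')) w = 1.
Proof.
move=> gr g1; have /cycleP[m rE] : cshift q' \in <[g]> by rewrite chi_gen // cycle_id.
have /cycleP[k gE] := gr; split=> [w1|w1].
  by rewrite rE hcX w1 expg1n.
by rewrite gE hcX w1 expg1n.
Qed.

Let neckE x : gen (neck (q := q) y) x <-> gen y x /\ chi x = 1.
Proof.
rewrite neck_gen; split=> [[w /= w0 <-]|[[w _ <-]]].
  split; first exact: genP.
  have := chi_cshift (ev y w); rewrite /chi extE // => /cycleP[k kE].
  rewrite kE; apply/eqP; rewrite cshiftX_eq1.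
  have := congr1 val w0; rewrite kE cshiftXE /= inordK ?ltn_pmod //.
  by move/eqP.
by rewrite /chi extE // => w1; exists w => //=; rewrite w1 perm1.
Qed.

(** Some basis element has a non-trivial image, since otherwise [gen a] would
    have at least [q] cosets. As [q] is prime all images are powers of this one,
    and the other basis elements can be divided by powers of this element. *)
Let cyclic_position (J : finType) (a : J -> F) (s : seq F) :
  framing a -> gen a `<=` gen y ->
  (forall x, exists2 z, z \in s & gen a (z^-1 * x)) -> size s < q ->
  exists a' : option 'I_(#|J|.-1) -> F,
    [/\ framing a', gen a' = gen a, chi (a' None) != 1 &
        forall i, chi (a' (Some i)) = 1].
Proof.
move=> fra ay sP sq; have aj j : gen y (a j) by apply/ay/gen_gen.
have gY := gen_subgroup y.
have [j j1] : exists j, chi (a j) != 1.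
  apply: contrapT => nE; have chi1 x : gen a x -> chi x = 1.
    move=> [w _ <-]; rewrite /chi ext_ev //.
    have E j : ext y (@cshift_action Z q') (a j) = 1.
      by apply/eqP/negPn/negP => n1; apply: nE; exists j.
    rewrite (eq_ev E); elim: w => [//|[b j] w IH]; rewrite ev_cons IH.
    by case: b; rewrite /= ?invg1 mulg1.
  have [r rP] : {r : 'I_q -> F & forall i, r i \in s /\ gen a ((r i)^-1 * y None ^+ i)}.
    apply: (@choice _ _ (fun (i : 'I_q) z => z \in s /\ gen a (z^-1 * y None ^+ i))) => i.
    by have [z zs za] := sP (y None ^+ i); exists z.
  have yX k : gen y (y None ^+ k) /\ chi (y None ^+ k) = cshift q' ^+ k.
    by rewrite -ev_nseq; split; [apply: genP|rewrite /chi extE // ev_nseq].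
  have rinj : injective r.
    move=> i k ik; have [_ ri] := rP i; have [_ rk] := rP k.
    have := chi1 _ (subgroupM (gen_subgroup a) (subgroupV (gen_subgroup a) ri) rk).
    have [yi ei] := yX i; have [yk ek] := yX k; have yiV := subgroupV gY yi.
    rewrite ik invgM invgK mulgA mulgK /chi extM // extV // -!/(chi _) ei ek.
    move=> /(congr1 (mulg (cshift q' ^+ i))); rewrite mulVKg mulg1.
    move=> /(congr1 (fun g : {perm 'I_q} => g ord0)).
    rewrite !cshiftXE !modn_small // => /(congr1 val) /=.
    by rewrite !inordK // => ki; apply/val_inj.
  have : size [seq r i | i <- enum 'I_q] <= size s.
    apply: uniq_leq_size; first by rewrite map_inj_uniq ?enum_uniq.
    by move=> _ /mapP[i _ ->]; case: (rP i).
  by rewrite size_map size_enum_ord leqNgt sq.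
have J0 : 0 < #|J| by apply/card_gt0P; exists j.
have [f0 bf0] : exists f : option 'I_(#|J|.-1) -> J, bijective f.
  by apply: card_bij; rewrite card_option card_ord prednK.
pose f k := tperm (f0 None) j (f0 k).
have bf : bijective f.
  have [g fK gK] := bf0; exists (fun k => g (tperm (f0 None) j k)) => k.
    by rewrite /f tpermK fK.
  by rewrite /f gK tpermK.
have fN : f None = j by rewrite /f tpermL.
have [fr2 g2] := framing_reindex bf fra.
set g := chi (a j) in j1.
have [k kP] : {k : 'I_(#|J|.-1) -> nat & forall i, chi (a (f (Some i))) = g ^+ k i}.
  apply: (@choice _ _ (fun i m => chi (a (f (Some i))) = g ^+ m)) => i.
  by apply/cycleP; rewrite chi_gen ?chi_cshift.
pose s2 b (l : option 'I_(#|J|.-1)) : word (option 'I_(#|J|.-1)) :=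
  if l is Some i then (false, l) :: nseq (k i) (b, None) else [:: (false, None)].
have evn b (H : groupType) (h : option 'I_(#|J|.-1) -> H) m :
    ev h (nseq m (b, None)) = sgn b (h None) ^+ m.
  by elim: m => [|m IH]; rewrite ?expg0 // expgS -IH.
have ss (H : groupType) (h : option 'I_(#|J|.-1) -> H) b l :
    ev (fun l => ev h (s2 b l)) (s2 (~~ b) l) = h l.
  case: l => [i|]; last by rewrite /= !mulg1.
  rewrite ev_cons evn /= evn mulg1 sgnV expgVn.
  by rewrite mulgK.
have [||fr3 g3] := framing_subst (s := s2 true) (s' := s2 false) fr2.
- by move=> H h l; apply: (ss H h true).
- by move=> H h l; apply: (ss H h false).
exists (fun l => ev (a \o f) (s2 true l)); split=> //; first by rewrite g3.
  by rewrite /= mulg1 fN.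
move=> i; have -> : ev (a \o f) (s2 true (Some i)) = a (f (Some i)) * (a j) ^- k i.
  by rewrite ev_cons evn /= fN expgVn.
have yX m : gen y (a j ^+ m) /\ chi (a j ^+ m) = g ^+ m.
  elim: m => [|m [IH1 IH2]].
    by split; [apply: subgroup1 gY|rewrite expg0 /chi (extE _ fy [::])].
  by split; rewrite expgS; [apply: subgroupM gY _ IH1|rewrite /chi extM // -!/(chi _) IH2 expgS].
have [yk1 yk2] := yX (k i); rewrite /chi extM ?extV //; last by apply: subgroupV gY yk1.
by rewrite -!/(chi _) yk2 kP mulgV.
Qed.

(** In bases in cyclic position the same words lie in the kernel of the map to
    the cyclic group of order [q], whatever the two non-trivial images are. The
    two intersections with this kernel have the same index by comparing ranks. *)
Lemma prime_cover c A B (s s' : seq F) : fi_subgroup A -> fi_subgroup B ->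
  A `<=` gen y -> B `<=` gen y -> carries c A B ->
  (forall x, exists2 z, z \in s & A (z^-1 * x)) -> size s < q ->
  (forall x, exists2 z, z \in s' & B (z^-1 * x)) -> size s' < q ->
  let e := neck (q := q) y in
  exists (T T' : finType) (p : option ('I_q * Z) -> {perm T}) (o : T)
         (p' : option ('I_q * Z) -> {perm T'}) (o' : T') (c1 : Comm F),
    [/\ forall v, exists w, ev p w o = v, forall v, exists w, ev p' w o' = v,
        #|T| <= size s, #|T| = #|T'| &
        quo N c = quo N c1 /\ carries c1 (stab e p o) (stab e p' o')].
Proof.
move=> fiA fiB Ay By cAB sP sq s'P s'q e.
have [J [a [fra aA _ _]]] := fi_framing Z0 fry em fiA Ay.
have [b cab bB] := carries_moves cAB aA.
have frb := moves_framing cab fra.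
have [||a' [fra' a'A a'1 a'0]] := cyclic_position fra _ _ sq; rewrite ?aA //.
have [||b' [frb' b'B b'1 b'0]] := cyclic_position frb _ _ s'q; rewrite ?bB //.
rewrite aA in a'A; rewrite bB in b'B.
have [c1 m1] := moves_ex fra' frb'.
have fre : framing e := neck_framing q' fry.
have [T [p [o [Ts tr pA]]]] := coset_action e (proj1 fiA) sP.
have [T' [p' [o' [T's tr' pB]]]] := coset_action e (proj1 fiB) s'P.
have kerE (I : Type) (x : option I -> F) D : gen x = D -> D `<=` gen y ->
    chi (x None) != 1 -> (forall i, chi (x (Some i)) = 1) ->
    [set ev x w | w in [set w | ev (hc (cshift q')) w = 1]] = D `&` gen e.
  move=> xD Dy x1 x0; have xy k : gen y (x k) by apply: Dy; rewrite -xD; apply: gen_gen.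
  have evx w : chi (ev x w) = 1 <-> ev (hc (cshift q')) w = 1.
    rewrite -(hc1 _ (chi_cshift (x None)) x1) /chi ext_ev //.
    suff -> : ev (fun k => ext y (@cshift_action Z q') (x k)) w =
      ev (hc (chi (x None))) w by [].
    by apply: eq_ev => -[i|] //=; apply: x0.
  apply/seteqP; split=> [_ [w /= w1 <-]|z []].
    split; first by rewrite -xD; apply: genP.
    by apply/neckE; split; [apply: Dy; rewrite -xD; apply: genP|apply/evx].
  by rewrite -{1}xD => -[w _ <-] /neckE[_ /evx w1]; exists w.
have c1st : carries c1 (stab e p o) (stab e p' o').
  have := moves_words (fun w => ev (hc (cshift q')) w = 1) m1.
  by rewrite (kerE _ a' A) // (kerE _ b' B) // (stab_eq pA) (stab_eq pB).
exists T, T', p, o, p', o', c1; split=> //; last first.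
  split=> //; apply: (quo_carries Z0 fry em fiB By cAB).
  by have := moves_gen m1; rewrite a'A b'B.
have [I [x [frx gx cI]]] := stab_framing fre tr.
have [I' [x' [frx' gx' cI']]] := stab_framing fre tr'.
have [z mz gz] := carries_moves c1st gx.
(* The isomorphic stabilizers have the same rank, hence the same index. *)
have II' : #|I| = #|I'|.
  by apply: (framing_rank (moves_framing mz frx) frx'); rewrite gz gx'.
move: cI cI'; rewrite -II' card_option card_prod card_ord !mulnS => h1 h2.
have h3 : (#|T| * (q * #|Z|) = #|T'| * (q * #|Z|))%N by lia.
by apply/eqP; rewrite -(@eqn_pmul2r (q * #|Z|)) ?h3 // muln_gt0 Z0.
Qed.

End PrimeCover.
End NormalPosition.

Lemma leq_fact m n : m <= n -> m`! <= n`!.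
Proof.
apply: (homo_leq (f := factorial) leqnn leq_trans) => k.
by rewrite factS leq_pmull.
Qed.

Lemma stab_reindex (G : groupType) (I J : Type) (T : finType) (e : J -> G)
    (f : I -> J) (p : J -> {perm T}) (o : T) :
  bijective f -> stab (e \o f) (p \o f) o = stab e p o.
Proof.
move=> [g fK gK]; apply/seteqP; split=> _ [w /= wo <-].
  exists (wsub (fun i => [:: (false, f i)]) w); rewrite /= ev_wsub.
    by rewrite (eq_ev (a' := p \o f)) // => i; rewrite ev1.
  by apply: eq_ev => i; rewrite ev1.
exists (wsub (fun j => [:: (false, g j)]) w); rewrite /= ev_wsub.
  by rewrite (eq_ev (a' := p)) // => j; rewrite ev1 /= gK.
by apply: eq_ev => j; rewrite ev1 /= gK.
Qed.

(** * The quotient is abelian *)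

Section Commute.
Variables (F : groupType) (N : normal_subgroup (Comm F)).
Variables (Z : finType) (y : option Z -> F).
Hypotheses (Z0 : 0 < #|Z|) (fry : framing y).
Hypothesis em : forall m, 0 < m -> elementary_in N (m * #|Z|).+1.

(** [prime_cover], [normal_position] and [half_covering_change] together, the
    choices made on the way being invisible modulo [N] by [quo_carries]. *)
Lemma quo_half_change q' c A B (s s' : seq F) (a b : nat)
    (eh : 'I_a + 'I_b -> F) :
  prime q'.+1 -> fi_subgroup A -> fi_subgroup B ->
  A `<=` gen y -> B `<=` gen y -> carries c A B ->
  (forall x, exists2 z, z \in s & A (z^-1 * x)) -> size s < q'.+1 ->
  (forall x, exists2 z, z \in s' & B (z^-1 * x)) -> size s' < q'.+1 ->
  framing eh -> gen eh = gen (neck (q := q'.+1) y) -> (size s)`! <= a ->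
  exists (T T' : finType) (p : 'I_a -> {perm T}) (o : T)
         (p' : 'I_a -> {perm T'}) (o' : T') (r : Comm F),
    quo N c = quo N r /\
    forall (U : finType) (u : 'I_b -> {perm U}) (z : U),
      carries r (stab eh (act_left p) o `&` stab eh (act_right u) z)
                (stab eh (act_left p') o' `&` stab eh (act_right u) z).
Proof.
move=> q_prime fiA fiB Ay By cAB sP sq s'P s'q freh ehE sa.
set e := neck (q := q'.+1) y in ehE.
have fre : framing e := neck_framing q' fry.
have ey : gen e `<=` gen y by rewrite neck_gen; apply: stab_sub.
have ehy : gen eh `<=` gen y by rewrite ehE.
have [T [T' [p [o [p' [o' [c1 [tr tr' Ts TT [cc1 c1P]]]]]]]]] :=
  prime_cover Z0 fry em q_prime fiA fiB Ay By cAB sP sq s'P s'q.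
have abK : (a + b)%N = #|{: option ('I_q'.+1 * Z)}|.
  by have := framing_rank freh fre ehE; rewrite card_sum !card_ord.
have K0 : 0 < #|{: option ('I_q'.+1 * Z)}| by rewrite card_option.
have permT (V : finType) : #|V| <= size s -> #|{perm V}| <= a.
  move=> Vs; apply: leq_trans sa; apply: leq_trans (leq_fact Vs).
  rewrite -[#|V|]cardsT -card_perm; apply: subset_leq_card.
  by apply/fintype.subsetP => g _; rewrite unfold_in; apply/fintype.subsetP.
have pT := permT T Ts; have pT' : #|{perm T'}| <= a by apply: permT; rewrite -TT.
have [n Nn [ph nP trh]] := normal_position Z0 fry em fre ey tr freh ehE abK K0 pT.
have [n' Nn' [ph' n'P trh']] := normal_position Z0 fry em fre ey tr' freh ehE abK K0 pT'.
have [r rP rU] := half_covering_change freh TT trh trh'.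
exists T, T', ph, o, ph', o', r; split=> //.
have -> : quo N r = quo N (n^-1 * (c1 * n')).
  apply: (quo_carries Z0 fry em (stab_fi (act_left ph') o' freh) _ rP).
    by apply: subset_trans ehy; apply: stab_sub.
  apply: carries_mul (carries_inv nP) _; exact: carries_mul c1P n'P.
have q1 k : nsub N k -> quo N k = 1.
  by move=> Nk; apply/esym/quoP; rewrite invg1 mul1g.
rewrite -!quoM -quoV (q1 _ Nn) (q1 _ Nn') cc1.
by rewrite invg1 mul1g mulg1.
Qed.

(** The classes [c] and [d] are replaced by [r] and [t], which act on the two
    halves of one basis. The products [r * t] and [t * r] both carry the
    stabilizer for the actions [p] and [u] to the one for [p'] and [u']. *)
Lemma quo_commute (c d : Comm F) : quo N c * quo N d = quo N d * quo N c.
Proof.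
pose f := comm_repr c; pose g := comm_repr d.
have fiY : fi_subgroup (gen y) := proj2 fry.
pose A := gen y `&` ((vdom f `&` f @^-1` gen y) `&` (vdom g `&` g @^-1` gen y)).
have fiA : fi_subgroup A.
  by apply: fi_subgroupI => //; apply: fi_subgroupI; apply: fi_subgroup_preimage.
have Ay : A `<=` gen y by move=> x [].
have cA : carries c A [set f x | x in A].
  by exists f; [apply: comm_reprK|split=> // x [_ [[]]]].
have dA : carries d A [set g x | x in A].
  by exists g; [apply: comm_reprK|split=> // x [_ [_ []]]].
set B := [set f x | x in A] in cA; set D := [set g x | x in A] in dA.
have By : B `<=` gen y by move=> _ [x [_ [[_ fx] _]] <-].
have Dy : D `<=` gen y by move=> _ [x [_ [_ [_ gx]]] <-].
have fiB := carries_fi cA fiA; have fiD := carries_fi dA fiA.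
have [_ [sA sAP]] := (fi_subgroupP _).1 fiA.
have [_ [sB sBP]] := (fi_subgroupP _).1 fiB.
have [_ [sD sDP]] := (fi_subgroupP _).1 fiD.
(* [M] bounds the number of permutations of the points of either covering, so
   both halves of a basis of the cyclic cover must have at least [M] elements. *)
pose M := (size sA)`!.
have [q /= qM q_prime] := prime_above (M + M + size sA + size sB + size sD).
have [q' qE] : exists q', q = q'.+1 by exists q.-1; rewrite prednK // prime_gt0.
rewrite {q}qE in qM q_prime.
have cK : #|{: option ('I_q'.+1 * Z)}| = (M + (q'.+1 * #|Z| - M).+1)%N.
  rewrite card_option card_prod card_ord.
  have : q'.+1 <= q'.+1 * #|Z| by rewrite leq_pmulr.
  lia.
pose b := (q'.+1 * #|Z| - M).+1.
have Mb : M <= b.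
  have : q'.+1 <= q'.+1 * #|Z| by rewrite leq_pmulr.
  rewrite /b; lia.
have [th bth] : exists th : 'I_M + 'I_b -> option ('I_q'.+1 * Z), bijective th.
  by apply: card_bij; rewrite card_sum !card_ord cK.
have [freh ehE] := framing_reindex bth (neck_framing q' fry).
set eh := _ \o th in freh ehE.
pose sw (k : 'I_b + 'I_M) : 'I_M + 'I_b :=
  match k with inl i => inr i | inr j => inl j end.
have bsw : bijective sw.
  by exists (fun k => match k with inl i => inr i | inr j => inl j end); case.
have [fres esE] := framing_reindex bsw freh.
have [T [T' [p [o [p' [o' [r [cr rP]]]]]]]] :=
  quo_half_change q_prime fiA fiB Ay By cA sAP ltac:(lia) sBP ltac:(lia) freh ehE (leqnn _).
have [U [U' [u [z [u' [z' [t [dt tP]]]]]]]] :=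
  quo_half_change q_prime fiA fiD Ay Dy dA sAP ltac:(lia) sDP ltac:(lia) fres
    (etrans esE ehE) Mb.
have swl (V : finType) (v : 'I_b -> {perm V}) x :
    stab (eh \o sw) (act_left v) x = stab eh (act_right v) x.
  by rewrite -(stab_reindex eh (act_right v) x bsw); congr stab; apply/funext => -[].
have swr (V : finType) (v : 'I_M -> {perm V}) x :
    stab (eh \o sw) (act_right v) x = stab eh (act_left v) x.
  by rewrite -(stab_reindex eh (act_left v) x bsw); congr stab; apply/funext => -[].
have m1 := carries_mul (rP _ u z) _; have m2 := carries_mul (tP _ p o) _.
have tP' := tP _ p' o'; rewrite !swl !swr in m2 tP'.
rewrite setIC in tP'; rewrite [X in carries _ _ X]setIC in tP'.
have {}m1 := m1 _ _ tP'.
have rP' := rP _ u' z'; rewrite setIC in rP'; rewrite [X in carries _ _ X]setIC in rP'.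
have {}m2 := m2 _ _ rP'; rewrite setIC in m2; rewrite [X in carries _ _ X]setIC in m2.
rewrite cr dt !quoM; apply: (quo_carries Z0 fry em _ _ m1 m2).
  by apply: fi_subgroupI; apply: stab_fi.
by move=> x [/stab_sub + _]; rewrite ehE neck_gen; apply: stab_sub.
Qed.

End Commute.

Theorem corollary3 (F : groupType) (n : nat) (n_ge2 : (2 <= n)%N)
    (F_free : free_of_rank F n) (N : normal_subgroup (Comm F))
    (N_nontrivial : nsub N <> [set 1%g]%classic) :
  abelian_group (quotient_group N).
Proof.
have [b /free_basis_framing[frb genb]] := F_free.
have [Z [y [Z0 fry em]]] := good_framing frb genb n_ge2 N_nontrivial.
by move=> u v; rewrite -[u]quo_reprK -[v]quo_reprK; apply: (quo_commute Z0 fry em).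
Qed.
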